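(* Fix $k\in\mathbb{N}_0$. Let $d\to\infty$ and let $n=n(d)\geq d$ be an integer-valued function of $d$ such that the limit $$\gamma:=\lim_{d\to\infty}\frac{\log(n(d))}{d}\in[0,\infty]$$ exists. Let $x\in\mathbb{R}^n$ be a random signal with $k$ jumps in the Weyl chamber $B^{(n)}=\{x\in\mathbb{R}^n:x_1\geq x_2\geq\cdots\geq x_n\geq0\}$, constructed as described in the context, and let $G:\mathbb{R}^n\to\mathbb{R}^d$ be a Gaussian random matrix independent of $x$. Then $$\lim_{d\to\infty}\mathbb{P}[\mathrm{Unique}(G,x,B^{(n)})]=\begin{cases}1,&\text{if }\gamma<\frac{1}{k+\frac12},\\[2pt]0,&\text{if }\gamma>\frac{1}{k+\frac12}.\end{cases}$$ In the critical case $\gamma=\frac{1}{k+\frac12}$, if $$\log(n(d))=\frac{1}{k+\frac12}\bigl(d+c\sqrt d+o(\sqrt d)\bigr)$$ for some constant $c\in\mathbb{R}$, then $$\lim_{d\to\infty}\mathbb{P}[\mathrm{Unique}(G,x,B^{(n)})]=\frac{1}{\sqrt{2\pi}}\int_{-\infty}^{-c}e^{-y^2/2}\,dy.$$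
   Context: $\mathbb{N}_0=\{0,1,2,\ldots\}$. Random signal: let $0<k\leq n$ and positive numbers $a_1,\ldots,a_k$ be given. Select a uniformly random $k$-element subset $\{i_1,\ldots,i_k\}$ of $\{1,\ldots,n\}$ with $1\leq i_1<\cdots<i_k\leq n$ and define $x=(x_1,\ldots,x_n)$ by $x_m=\sum_{l=1}^ka_l\mathbf{1}_{\{i_l\geq m\}}$, $m=1,\ldots,n$. For $k=0$ put $x=0$. A Gaussian random matrix $G:\mathbb{R}^n\to\mathbb{R}^d$ is a $d\times n$ matrix with i.i.d. standard normal entries. For a polyhedral set $P\subseteq\mathbb{R}^n$ and $x\in P$, $\mathrm{Unique}(G,x,P)$ is the event that $x$ is uniquely determined within $P$ by $y=Gx$, i.e. the event $(x+\ker G)\cap P=\{x\}$. The following known formula may be used as a given: for $0\leq k\leq d\leq n$, $$\mathbb{P}[\mathrm{Unique}(G,x,B^{(n)})]=\frac{2\,k!}{n!\binom nk}\sum_{l=0}^\infty\genfrac{[}{]}{0pt}{}{n}{d-2l-1}_{1/2}\genfrac{\{}{\}}{0pt}{}{d-2l-1}{k}_{1/2}.$$ Here, with $\genfrac{[}{]}{0pt}{}{n}{k}$, $\genfrac{\{}{\}}{0pt}{}{n}{k}$ the unsigned Stirling numbers of the first and second kind, the $r$-Stirling numbers for real $r$ are $\genfrac{[}{]}{0pt}{}{n}{k}_r=\sum_{j=k}^n\genfrac{[}{]}{0pt}{}{n}{j}\binom jk r^{j-k}$ and $\genfrac{\{}{\}}{0pt}{}{n}{k}_r=\sum_{j=k}^n\binom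 nj\genfrac{\{}{\}}{0pt}{}{j}{k}r^{n-j}$ for $0\le k\le n$; they are $0$ for $k<0$ or $k>n$, and terms with a negative upper or lower index $d-2l-1$ are $0$. *)

(* Defs.v *)
From HB Require Import structures.
From mathcomp Require Import all_boot all_order all_algebra.
From mathcomp Require Import all_classical all_reals all_analysis.

Set Implicit Arguments.
Unset Strict Implicit.
Unset Printing Implicit Defensive.

Import Order.TTheory GRing.Theory Num.Theory.
Import numFieldNormedType.Exports.

Local Open Scope classical_set_scope.
Local Open Scope ring_scope.

Fixpoint stirling1 (n k : nat) : nat :=
  match n, k with
  | 0, 0 => 1
  | 0, _.+1 => 0
  | _.+1, 0 => 0
  | n'.+1, k'.+1 => n' * stirling1 n' k + stirling1 n' k'
  end%N.

Fixpoint stirling2 (n k : nat) : nat :=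
  match n, k with
  | 0, 0 => 1
  | 0, _.+1 => 0
  | _.+1, 0 => 0
  | n'.+1, k'.+1 => k * stirling2 n' k + stirling2 n' k'
  end%N.

Definition rstirling1 (R : realType) (r : R) (n k : nat) : R :=
  \sum_(k <= j < n.+1) (stirling1 n j)%:R * 'C(j, k)%:R * r ^+ (j - k).

Definition rstirling2 (R : realType) (r : R) (n k : nat) : R :=
  \sum_(k <= j < n.+1) 'C(n, j)%:R * (stirling2 j k)%:R * r ^+ (n - j).

(* The guard [2 * l < d] keeps exactly the terms of the infinite sum whose
   index d - 2l - 1 is nonnegative; the other terms are 0 by convention. *)
Definition unique_value (R : realType) (k d n : nat) : R :=
  2 * (k`!)%:R / ((n`!)%:R * 'C(n, k)%:R) *
  \sum_(l < d | (2 * l < d)%N)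
     rstirling1 2^-1 n (d - 2 * l - 1) * rstirling2 2^-1 (d - 2 * l - 1) k.

Definition weyl_chamber (R : realType) (n : nat) : set 'cV[R]_n :=
  [set x | (forall i j : 'I_n, (i <= j)%N -> x j 0 <= x i 0) /\
           (forall i : 'I_n, 0 <= x i 0)].

Definition kernel_set (R : realType) (d n : nat) (A : 'M[R]_(d, n)) :
  set 'cV[R]_n := [set v | A *m v = 0].

Definition unique_at (R : realType) (d n : nat)
    (A : 'M[R]_(d, n)) (x : 'cV[R]_n) (C : set 'cV[R]_n) : Prop :=
  [set x + v | v in kernel_set A] `&` C = [set x].

(* Indices run from 0, and [enum S] lists S in increasing order, so its l-th
   entry is i_(l+1).  The default value of [nth] is never used when #|S| = k. *)
Definition signal (R : realType) (k n : nat) (a : 'I_k -> R) (S : {set 'I_n}) :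
  'cV[R]_n :=
  \col_(m < n) \sum_(l < k)
     a l * (m <= nth 0%N [seq val i | i <- enum S] l)%N%:R.

Section RandomModel.
Context (R : realType) (disp : measure_display) (T : measurableType disp).
Variable P : probability T R.

Definition uniform_subset (k n : nat) (S : T -> {set 'I_n}) : Prop :=
  (forall w, #|S w| = k) /\
  (forall A : {set 'I_n}, #|A| = k ->
     measurable (S @^-1` [set A]) /\
     P (S @^-1` [set A]) = (('C(n, k)%:R)^-1)%:E).

Definition random_signal (k n : nat) (a : 'I_k -> R) (x : T -> 'cV[R]_n) :
  Prop :=
  exists2 S : T -> {set 'I_n}, uniform_subset k S
    & forall w, x w = signal a (S w).

Definition gaussian_matrix (d n : nat) (G : T -> 'M[R]_(d, n)) : Prop :=
  [/\ forall i j, measurable_fun [set: T] (fun w => G w i j),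
      forall i j (B : set R), measurable B ->
        P [set w | B (G w i j)] = normal_prob 0 1 B
    & forall B : 'I_d -> 'I_n -> set R, (forall i j, measurable (B i j)) ->
        P [set w | forall i j, B i j (G w i j)] =
        (\prod_(i < d) \prod_(j < n) P [set w | B i j (G w i j)])%E].

Definition sigma_mx (p q : nat) (M : T -> 'M[R]_(p, q)) : set_system T :=
  <<s [set E | exists i j, exists2 B : set R,
         measurable B & E = [set w | B (M w i j)]] >>.

Definition independent_mx (p q p' q' : nat)
    (M : T -> 'M[R]_(p, q)) (N : T -> 'M[R]_(p', q')) : Prop :=
  forall E F, sigma_mx M E -> sigma_mx N F -> P (E `&` F) = (P E * P F)%E.

Definition signal_model (k d n : nat) (a : 'I_k -> R)
    (x : T -> 'cV[R]_n) (G : T -> 'M[R]_(d, n)) : Prop :=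
  [/\ forall l, 0 < a l, random_signal a x, gaussian_matrix G
    & independent_mx x G].

Definition prob_unique (d n : nat)
    (x : T -> 'cV[R]_n) (G : T -> 'M[R]_(d, n)) : \bar R :=
  P [set w | unique_at (G w) (x w) (@weyl_chamber R n)].

End RandomModel.

(* The known formula, for every probability space carrying the model.  The
   case k = d = n is left out: there the tangent cone at x is all of R^n, so
   that the probability is 1, whereas the right-hand side is an empty sum. *)
Definition unique_formula (R : realType) : Prop :=
  forall (disp : measure_display) (T : measurableType disp)
         (P : probability T R) (k d n : nat) (a : 'I_k -> R)
         (x : T -> 'cV[R]_n) (G : T -> 'M[R]_(d, n)),
    (k <= d)%N -> (d <= n)%N -> (k < n)%N ->
    signal_model P a x G ->
    prob_unique P x G = (unique_value R k d n)%:E.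

(* Main.v *)
Require Import Defs.
From HB Require Import structures.
From mathcomp Require Import all_boot all_order all_algebra.
From mathcomp Require Import all_classical all_reals all_analysis.
From mathcomp Require Import measurable_realfun ring lra zify.
Import Order.TTheory GRing.Theory Num.Theory.
Import numFieldNormedType.Exports.
Local Open Scope classical_set_scope.
Local Open Scope ring_scope.

(** The explicit formula for Stirling numbers of the second kind writes the
    known probability as an alternating sum over [i <= k], with weights
    ['C(k, i) * 'C(n + i, i) / 'C(n, k)], of
    [2 * \sum_l [t^(d - 2l - 1)] \prod_(j < n) (p_j t + 1 - p_j)], where
    [p_j = (i + 1/2) / (i + j + 1)].  As [p_i = 1/2], the factor [j = i] is
    [(1 + t) / 2], and the sum over one parity class becomes the probability
    that fewer than [d] of the independent Bernoulli trials [j <> i] succeed.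
    For fixed [k] only the weight of [i = k] survives, and the number of
    successes then has mean and variance [(k + 1/2) ln n + O(1)].  The
    asymptotic normality of this number comes from Lindeberg's replacement
    method applied to the explicit solution [std_cdf (y / sqrt t)] of the heat
    equation, so that no Gaussian convolution is ever needed. *)

(** * Calculus and the standard normal distribution *)

Section Calculus.
Context {R : realType}.
Implicit Types (f g df : R -> R) (x a b B C : R).

Lemma is_derive_compf f g x a b : is_derive (g x) 1 f a -> is_derive x 1 g b ->
  is_derive x 1 (fun y => f (g y)) (a * b).
Proof. by move=> fa gb; apply: (@is_derive1_comp _ f g). Qed.

(** The mean value inequality; [min] and [max] admit the endpoints in either order, as the
    increments below have both signs. *)
Lemma derive_bound f df B a b :
  (forall x, Num.min a b <= x <= Num.max a b ->
     is_derive x 1 f (df x) /\ `|df x| <= B) ->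
  `|f b - f a| <= B * `|b - a|.
Proof.
wlog ab : a b / a <= b.
  move=> H H'; have [ab|/ltW ba] := leP a b; first exact: H.
  by rewrite distrC (distrC b); apply: H => // x; rewrite minC maxC; apply: H'.
rewrite min_l// max_r// => H.
have [| |c cab ->] := @MVT_segment _ f df a b ab.
- by move=> x xab; apply: (H x _).1; rewrite !ltW ?(itvP xab).
- apply: derivable_within_continuous => c cab.
  by have [[]] := H c cab.
- by rewrite normrM ler_wpM2r//; apply: (H c _).2; rewrite !(itvP cab).
Qed.

Lemma derive_bound_lip f df B a b : (forall x, is_derive x 1 f (df x)) ->
  (forall x, `|df x| <= B) -> `|f b - f a| <= B * `|b - a|.
Proof. by move=> H1 H2; apply: derive_bound => x _; split; eauto. Qed.

(** Each application gains one power of [|b|], so that iteration yields Taylor remainders; the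
    constant is not optimized. *)
Lemma derive_bound_pow f df C b m : (forall x, is_derive x 1 f (df x)) ->
  f 0 = 0 -> 0 <= C -> (forall x, `|df x| <= C * `|x| ^+ m) ->
  `|f b| <= C * `|b| ^+ m.+1.
Proof.
move=> Hd f0 C0 Hb.
rewrite exprSr mulrA; have := @derive_bound f df (C * `|b| ^+ m) 0 b.
rewrite f0 !subr0; apply => x xb; split => //; apply: (le_trans (Hb x)).
apply: ler_wpM2l => //; apply: lerXn2r; rewrite ?nnegrE//.
move: xb; case: (leP 0 b) => b0 /andP[h1 h2].
  by rewrite !ger0_norm.
by rewrite !ler0_norm ?lerN2// ltW.
Qed.
End Calculus.

(** * The normal density and distribution function *)

Section NormalDistribution.
Context {R : realType}.
Implicit Types x y : R.
Notation mu := (@lebesgue_measure R).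

Definition std_pdf x : R := (Num.sqrt (2 * pi))^-1 * expR (- (x ^+ 2) / 2).

Lemma std_pdfE : std_pdf = normal_pdf 0 1.
Proof.
apply/funext => x; rewrite normal_pdfE ?oner_neq0// /normal_peak /normal_fun.
by rewrite subr0 !expr1n mul1r /std_pdf mulr_natl.
Qed.

Lemma std_pdf_ge0 x : 0 <= std_pdf x.
Proof. by rewrite mulr_ge0 ?expR_ge0// invr_ge0 sqrtr_ge0. Qed.

Definition std_cdf x : R := \int[mu]_(t in `]-oo, x]) std_pdf t.

Lemma integrable_std_pdf (A : set R) : measurable A ->
  mu.-integrable A (EFin \o std_pdf).
Proof.
move=> mA; rewrite std_pdfE.
by apply: (integrableS _ _ (subsetT _)) => //; exact: integrable_normal_pdf.
Qed.

Global Instance is_derive_std_cdf x : is_derive x 1 std_cdf (std_pdf x).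
Proof.
have [] := @continuous_FTC1 R std_pdf -oo%O x (x + 1).
- by rewrite ltrDl.
- exact: integrable_std_pdf.
- by rewrite ltNyr.
- by rewrite std_pdfE; apply: continuous_normal_pdf; rewrite oner_neq0.
- by move=> H1 H2; rewrite -H2 derive1E; exact: derivableP.
Qed.

(** The identity as a random variable under the normal law: its [cdf] is [std_cdf], which thus
    inherits bounds, monotonicity and limits at infinity. *)
Let idTR : measurableTypeR R -> R := idfun.

#[local] HB.instance Definition _ :=
  @isMeasurableFun.Build _ _ _ _ idTR (@measurable_id _ _ setT).

Let stdX : {RV (@normal_prob R 0 1) >-> R} := idTR.

Lemma std_cdfE x : (std_cdf x)%:E = cdf stdX x.
Proof.
rewrite /cdf/= /distribution /pushforward/= preimage_id /normal_prob -std_pdfE.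
rewrite /std_cdf /Rintegral fineK//.
by apply: integrable_fin_num => //; exact: integrable_std_pdf.
Qed.

Lemma std_cdf_integral x : (std_cdf x)%:E = (((Num.sqrt (2 * pi))^-1)%:E *
  \int[mu]_(y in `]-oo, x]%classic) (expR (- (y ^+ 2) / 2))%:E)%E.
Proof.
rewrite /std_cdf /Rintegral fineK; last first.
  by apply: integrable_fin_num => //; exact: integrable_std_pdf.
rewrite -ge0_integralZl//=.
apply/measurable_EFinP/measurable_funTS.
rewrite (_ : (fun _ => _) = normal_fun 0 1); last first.
  by apply/funext => y; rewrite /normal_fun subr0 expr1n.
exact: measurable_normal_fun.
Qed.

Lemma std_cdf_ge0 x : 0 <= std_cdf x.
Proof. by rewrite -lee_fin std_cdfE cdf_ge0. Qed.

Lemma std_cdf_le1 x : std_cdf x <= 1.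
Proof. by rewrite -lee_fin std_cdfE cdf_le1. Qed.

Lemma std_cdf_mono : {homo std_cdf : x y / x <= y}.
Proof. by move=> x y xy; rewrite -lee_fin !std_cdfE cdf_nondecreasing. Qed.

Lemma cvg_std_cdfy : std_cdf @ +oo --> (1 : R).
Proof.
have := @cvg_cdfy1 _ _ _ _ stdX.
rewrite (_ : cdf stdX = EFin \o std_cdf) => [/fine_cvgP[_]//|].
by apply/funext => x; rewrite -std_cdfE.
Qed.

Lemma cvg_std_cdfNy : std_cdf @ -oo --> (0 : R).
Proof.
have := @cvg_cdfNy0 _ _ _ _ stdX.
rewrite (_ : cdf stdX = EFin \o std_cdf) => [/fine_cvgP[_]//|].
by apply/funext => x; rewrite -std_cdfE.
Qed.

Lemma continuous_std_cdf : continuous std_cdf.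
Proof.
move=> x; apply: differentiable_continuous; apply/derivable1_diffP.
by have [] := is_derive_std_cdf x.
Qed.
End NormalDistribution.

(** * Taylor and scaling estimates for the normal distribution function *)

Section OneStep.
Context {R : realType}.
Implicit Types x y h p : R.

Global Instance is_derive_std_pdf x :
  is_derive x 1 (@std_pdf R) (- x * std_pdf x).
Proof.
rewrite /std_pdf; apply: is_derive_eq; rewrite /GRing.scale/=.
by set c := _^-1; set e := expR _; field.
Qed.

Local Typeclasses Opaque std_pdf.

(** Follows from [expR (x ^+ 2 / 2) = expR (x ^+ 2 / 4) ^+ 2] and [expR t >= 1 + t]. It bounds
    polynomials of degree at most 4 times the density, uniformly in [x]. *)
Lemma std_pdf_le x : (1 + x ^+ 4) * std_pdf x <= 17.
Proof.
have c1 : (Num.sqrt (2 * pi) : R)^-1 <= 1.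
  rewrite invf_le1 ?sqrtr_gt0 ?mulr_gt0 ?pi_gt0//.
  rewrite -[leLHS]sqrtr1 ler_wsqrtr//; have := pi_ge2 R; lra.
have c0 : 0 <= (Num.sqrt (2 * pi) : R)^-1 by rewrite invr_ge0 sqrtr_ge0.
rewrite /std_pdf mulrCA; set c := _^-1 in c1 c0 *.
suff : (1 + x ^+ 4) * expR (- x ^+ 2 / 2) <= 17.
  by have := expR_ge0 (- x ^+ 2 / 2); nra.
rewrite mulNr expRN ler_pdivrMr ?expR_gt0//.
rewrite (_ : x ^+ 2 / 2 = x ^+ 2 / 4 + x ^+ 2 / 4); last by field.
rewrite expRD.
have := expR_ge1Dx (x ^+ 2 / 4); set e := expR _ => He.
have : 0 <= x ^+ 2 by rewrite sqr_ge0.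
by rewrite (_ : x ^+ 4 = x ^+ 2 * x ^+ 2); [nra|ring].
Qed.

Lemma poly_std_pdf_le (c q x : R) : 0 <= c -> `|q| <= c * (1 + x ^+ 4) ->
  `|q * std_pdf x| <= c * 17.
Proof.
move=> c0 qc; rewrite normrM (ger0_norm (std_pdf_ge0 x)).
apply: (le_trans (ler_wpM2r (std_pdf_ge0 x) qc)).
by rewrite -mulrA ler_wpM2l// std_pdf_le.
Qed.

(** The remainder [E] and its derivative [E1] vanish at 0, and the derivative [E2] of [E1] is at
    most [34 * |t|] because [y * std_pdf y] is Lipschitz. Two integrations give the cubic bound. *)
Lemma std_cdf_taylor x s :
  `|std_cdf (x + s) - std_cdf x - s * std_pdf x + s ^+ 2 / 2 * (x * std_pdf x)|
    <= 34 * `|s| ^+ 3.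
Proof.
pose E (t : R) : R := std_cdf (x + t) - std_cdf x - t * std_pdf x
  + t ^+ 2 / 2 * (x * std_pdf x).
pose E1 (t : R) : R := std_pdf (x + t) - std_pdf x + t * (x * std_pdf x).
pose E2 (t : R) : R := - (x + t) * std_pdf (x + t) + x * std_pdf x.
have dE (t : R) : is_derive t 1 E (E1 t).
  by rewrite /E /E1; apply: is_derive_eq; rewrite /GRing.scale/=; field.
have dE1 (t : R) : is_derive t 1 E1 (E2 t).
  by rewrite /E1 /E2; apply: is_derive_eq; rewrite /GRing.scale/=; ring.
have bE2 t : `|E2 t| <= 34 * `|t| ^+ 1.
  rewrite /E2.
  rewrite (_ : _ + _ = x * std_pdf x - (x + t) * std_pdf (x + t)); last by ring.
  rewrite distrC expr1 (_ : `|t| = `|(x + t) - x|); last by congr `|_|; ring.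
  pose dg (y : R) : R := (1 - y ^+ 2) * std_pdf y.
  apply: (@derive_bound_lip _ (fun y : R => y * std_pdf y) dg) => y.
    by apply: is_derive_eq; rewrite /dg /GRing.scale/=; ring.
  (* [|1 - y ^+ 2| <= 2 * (1 + y ^+ 4)], whence the Lipschitz constant 34. *)
  apply: le_trans (_ : 2 * 17 <= _); last by lra.
  apply: poly_std_pdf_le => //; rewrite ler_norml.
  have := sqr_ge0 (y ^+ 2); rewrite -exprM => y4.
  have := sqr_ge0 y => y2.
  have : 0 <= (y ^+ 2 - 1) ^+ 2 by exact: sqr_ge0.
  by rewrite (_ : (y ^+ 2 - 1) ^+ 2 = y ^+ 4 - 2 * y ^+ 2 + 1);
    [move=> ?; apply/andP; split; lra|ring].
have E10 : E1 0 = 0 by rewrite /E1 addr0; ring.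
have E0 : E 0 = 0 by rewrite /E addr0; ring.
rewrite -/(E s); apply: (@derive_bound_pow _ E E1) => // t.
exact: (@derive_bound_pow _ E1 E2).
Qed.

(** The derivative of [w * std_pdf (x * w)] in [w] depends on [x * w] only, so the Lipschitz
    constant is uniform in [x]. *)
Lemma std_pdf_scale x w : 0 <= w <= 1 ->
  `|std_pdf x - w * std_pdf (x * w)| <= 34 * (1 - w).
Proof.
move=> /andP[w0 w1].
have -> : std_pdf x - w * std_pdf (x * w) =
  1 * std_pdf (x * 1) - w * std_pdf (x * w) by rewrite mulr1 mul1r.
rewrite -[1 - w]ger0_norm ?subr_ge0//.
pose dg (w : R) : R := (1 - (x * w) ^+ 2) * std_pdf (x * w).
apply: (@derive_bound_lip _ (fun w => w * std_pdf (x * w)) dg) => y.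
  by apply: is_derive_eq; rewrite /dg /GRing.scale/=; ring.
apply: le_trans (_ : 2 * 17 <= _); last by lra.
apply: poly_std_pdf_le => //; rewrite ler_norml; set z := x * y.
have := sqr_ge0 (z ^+ 2); rewrite -exprM => y4.
have := sqr_ge0 z => y2.
have : 0 <= (z ^+ 2 - 1) ^+ 2 by exact: sqr_ge0.
by rewrite (_ : (z ^+ 2 - 1) ^+ 2 = z ^+ 4 - 2 * z ^+ 2 + 1);
  [move=> ?; apply/andP; split; lra|ring].
Qed.

(** With [z = x * w], the derivative in [w] is [w * (3 * z - z ^+ 3)] times the density at [z]. Its
    factor [w] is bounded by 1 only up to 1, so the derivative is estimated on the segment alone. *)
Lemma std_pdf_scale3 x w : 0 <= w <= 1 ->
  `|x * std_pdf x - x * w ^+ 3 * std_pdf (x * w)| <= 68 * (1 - w).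
Proof.
move=> /andP[w0 w1].
have -> : x * std_pdf x - x * w ^+ 3 * std_pdf (x * w) =
  x * 1 ^+ 3 * std_pdf (x * 1) - x * w ^+ 3 * std_pdf (x * w).
  by rewrite mulr1 expr1n mulr1.
rewrite -[1 - w]ger0_norm ?subr_ge0//.
pose dg (w : R) : R := (w * (3 * (x * w) - (x * w) ^+ 3)) * std_pdf (x * w).
apply: (@derive_bound _ (fun w => x * w ^+ 3 * std_pdf (x * w)) dg) => y.
rewrite min_l// max_r// => /andP[wy y1]; split.
  by apply: is_derive_eq; rewrite /dg /GRing.scale/=; ring.
apply: le_trans (_ : 4 * 17 <= _); last by lra.
apply: poly_std_pdf_le => //; set z := x * y.
have z4 : 0 <= z ^+ 4 by rewrite (_ : z ^+ 4 = (z ^+ 2) ^+ 2) ?sqr_ge0// -exprM.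
rewrite normrM ger0_norm ?(le_trans w0)// -[leRHS]mul1r.
apply: ler_pM => //; first exact: le_trans w0 wy.
rewrite ler_norml.
have := sqr_ge0 (z ^+ 2 - 1); have := sqr_ge0 (z * (z - 1)).
have := sqr_ge0 (z * (z + 1)); have := sqr_ge0 (z - 1); have := sqr_ge0 (z + 1).
rewrite (_ : (z ^+ 2 - 1) ^+ 2 = z ^+ 4 - 2 * z ^+ 2 + 1); last by ring.
rewrite (_ : (z * (z - 1)) ^+ 2 = z ^+ 4 - 2 * z ^+ 3 + z ^+ 2); last by ring.
rewrite (_ : (z * (z + 1)) ^+ 2 = z ^+ 4 + 2 * z ^+ 3 + z ^+ 2); last by ring.
rewrite (_ : (z - 1) ^+ 2 = z ^+ 2 - 2 * z + 1); last by ring.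
rewrite (_ : (z + 1) ^+ 2 = z ^+ 2 + 2 * z + 1); last by ring.
by move=> ? ? ? ? ?; apply/andP; split; lra.
Qed.
End OneStep.

(** * Replacing one Bernoulli variable *)

Section BernoulliStep.
Context {R : realType}.
Implicit Types x y h p : R.
Local Typeclasses Opaque std_pdf std_cdf.

(* The function of [p] on the left vanishes at [p = 0]; the second order Taylor
   terms of its derivative cancel because [std_cdf (y / sqrt t)] solves the heat
   equation, leaving an error of order [h ^ 3]. *)
Lemma std_cdf_bernoulli y p h : 0 <= p <= 1 -> 0 <= h <= 1 ->
  `|p * std_cdf (y - h) + (1 - p) * std_cdf y
    - std_cdf ((y - p * h) / Num.sqrt (1 + p * (1 - p) * h ^+ 2))|
  <= 200 * h ^+ 3 * p.
Proof.
move=> /andP[p0 p1] /andP[h0 h1].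
(* [w q] is the reciprocal standard deviation once the variance [q * (1 - q) * h ^+ 2] is added to
   1; [dD] is the derivative of [D]. *)
pose w (q : R) : R := (Num.sqrt (1 + q * (1 - q) * h ^+ 2))^-1.
pose D (q : R) : R := q * std_cdf (y - h) + (1 - q) * std_cdf y
  - std_cdf ((y - q * h) * w q).
pose dD (q : R) : R := std_cdf (y - h) - std_cdf y
  + std_pdf ((y - q * h) * w q) *
    (h * w q + (y - q * h) * (1 - 2 * q) * h ^+ 2 * w q ^+ 3 / 2).
have D0 : D 0 = 0.
  rewrite /D /w !(mul0r, subr0, addr0, mul1r, add0r) sqrtr1 invr1 mulr1.
  by rewrite subrr.
rewrite -/(w p) -/(D p).
have := @derive_bound _ D dD (200 * h ^+ 3) 0 p.
rewrite D0 !subr0 (ger0_norm p0) min_l// max_r//.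
apply=> q /andP[q0 qp].
have h2 : 0 <= h ^+ 2 by exact: sqr_ge0.
have h21 : h ^+ 2 <= 1 by rewrite expr_le1.
have q1 : q <= 1 by exact: le_trans qp p1.
have qq0 : 0 <= q * (1 - q) by rewrite mulr_ge0// subr_ge0.
have qq1 : q * (1 - q) <= 1 by nra.
have r1 : 1 <= 1 + q * (1 - q) * h ^+ 2 by rewrite lerDl mulr_ge0.
have r0 : 0 < 1 + q * (1 - q) * h ^+ 2 by exact: lt_le_trans r1.
have s0 : 0 < Num.sqrt (1 + q * (1 - q) * h ^+ 2) by rewrite sqrtr_gt0.
have w0 : 0 < w q by rewrite invr_gt0.
have w2 : w q ^+ 2 * (1 + q * (1 - q) * h ^+ 2) = 1.
  by rewrite /w exprVn sqr_sqrtr ?ltW// mulVf// gt_eqF.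
have w1 : w q <= 1.
  by rewrite invf_le1// -[leLHS]sqrtr1 ler_wsqrtr.
(* As [w q ^+ 2 <= w q], the left side is at most [1 - w q ^+ 2 = w q ^+ 2 * (q * (1 - q) * h ^+
   2)]. Scaling errors are thus of order [h ^+ 2]. *)
have w1h : 1 - w q <= h ^+ 2.
  have : w q ^+ 2 <= 1 by rewrite expr_le1// ltW.
  have : w q ^+ 2 <= w q by rewrite expr2 ler_piMr// ltW.
  have : 0 <= w q ^+ 2 by rewrite sqr_ge0.
  move: w2 qq1 qq0; set W := w q ^+ 2; set Q := q * (1 - q) => ? ? ? ? ? ?.
  have QH : Q * h ^+ 2 <= h ^+ 2 by rewrite ler_piMl.
  have QH0 : 0 <= Q * h ^+ 2 by rewrite mulr_ge0.
  by nra.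
split.
  have dw : is_derive q 1 w (- (1 - 2 * q) * h ^+ 2 * w q ^+ 3 / 2).
    have ds : is_derive q 1 (fun q => Num.sqrt (1 + q * (1 - q) * h ^+ 2))
        ((1 - 2 * q) * h ^+ 2 * w q / 2).
      apply: is_derive_eq.
        apply: (is_derive_compf Num.sqrt (fun q => 1 + q * (1 - q) * h ^+ 2)).
        by apply: is_derive1_sqrt.
      by rewrite /GRing.scale/= /w; field; rewrite gt_eqF.
    rewrite /w; apply: is_derive_eq.
      by apply: is_deriveV; rewrite gt_eqF.
    by rewrite /GRing.scale/= /w; field; rewrite gt_eqF.
  by rewrite /D /dD; apply: is_derive_eq; rewrite /GRing.scale/=; field.
(* Both [y = x + q * h] and [y - h = x - (1 - q) * h] are expanded around [x]. The second order
   terms differ by the factor [(1 - q) ^+ 2 - q ^+ 2 = 1 - 2 * q], so all terms of order at most 2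
   cancel those of [dD] up to the scaling errors [e3] and [e4]. *)
set x := y - q * h.
have := std_cdf_taylor x (q * h).
have := std_cdf_taylor x (- ((1 - q) * h)).
rewrite (_ : x + q * h = y); last by rewrite /x; ring.
rewrite (_ : x + - ((1 - q) * h) = y - h); last by rewrite /x; ring.
set e1 := (X in `|X| <= _) => He1; set e2 := (X in `|X| <= _) => He2.
have w01 : 0 <= w q <= 1 by rewrite (ltW w0).
have := std_pdf_scale x (w q) w01; have := std_pdf_scale3 x (w q) w01.
set e3 := (X in `|X| <= _) => He3; set e4 := (X in `|X| <= _) => He4.
have -> : dD q = e1 - e2 - h * e4 - h ^+ 2 * (1 - 2 * q) / 2 * e3.
  by rewrite /dD -/x /e1 /e2 /e3 /e4; field.
have h3 : 0 <= h ^+ 3 by rewrite exprn_ge0.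
have B1 : `|e1| <= 34 * h ^+ 3.
  apply: (le_trans He1); rewrite normrN ger0_norm ?mulr_ge0 ?subr_ge0//.
  rewrite ler_wpM2l// exprMn ler_piMl// expr_le1 ?subr_ge0//.
  by rewrite gerBl.
have B2 : `|e2| <= 34 * h ^+ 3.
  apply: (le_trans He2); rewrite ger0_norm ?mulr_ge0//.
  by rewrite ler_wpM2l// exprMn ler_piMl// expr_le1.
have B4 : `|h * e4| <= 34 * h ^+ 3.
  rewrite normrM ger0_norm//.
  rewrite (_ : 34 * h ^+ 3 = h * (34 * h ^+ 2)); last by ring.
  by rewrite ler_wpM2l// (le_trans He4)// ler_wpM2l.
have B3 : `|h ^+ 2 * (1 - 2 * q) / 2 * e3| <= 68 * h ^+ 3.
  rewrite normrM.
  apply: (@le_trans _ _ (h ^+ 2 * (68 * h ^+ 2))).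
    apply: ler_pM => //; last by rewrite (le_trans He3)// ler_wpM2l.
    rewrite -mulrA normrM ger0_norm// ler_piMr// ler_norml.
    by apply/andP; split; lra.
  rewrite (_ : h ^+ 2 * _ = 68 * h ^+ 3 * h); last by ring.
  by rewrite ler_piMr// mulr_ge0.
(* The four bounds add up to [170 * h ^+ 3]. *)
apply: (le_trans (ler_normB _ _)); apply: (le_trans (lerD (ler_normB _ _) B3)).
apply: (le_trans (lerD (lerD (ler_normB _ _) B4) (lexx _))).
by lra.
Qed.
End BernoulliStep.

(** * Sums of independent Bernoulli variables *)

Section PoissonBinomial.
Context {R : realType}.
Implicit Types (ps : seq R) (f g : nat -> R).

(* The expectation of [f X], for [X] a sum of independent Bernoulli variables
   with parameters [ps]. *)
Fixpoint pbin_expect ps f : R :=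
  if ps is p :: ps' then
    p * pbin_expect ps' (fun m => f m.+1) + (1 - p) * pbin_expect ps' f
  else f 0%N.

Definition pbin_mean ps : R := \sum_(p <- ps) p.
Definition pbin_var ps : R := \sum_(p <- ps) p * (1 - p).
Definition is_params ps := all (fun p => 0 <= p <= 1) ps.

Lemma pbin_var_ge0 ps : is_params ps -> 0 <= pbin_var ps.
Proof.
move=> /allP H; rewrite /pbin_var big_seq sumr_ge0// => p /H/andP[p0 p1].
by rewrite mulr_ge0// subr_ge0.
Qed.

Lemma pbin_expect_le ps f g : is_params ps -> (forall m, f m <= g m) ->
  pbin_expect ps f <= pbin_expect ps g.
Proof.
elim: ps f g => [|p ps IH] f g /=; first by move=> _; apply.
move=> /andP[/andP[p0 p1] hps] fg.
by apply: lerD; apply: ler_wpM2l; rewrite ?subr_ge0//; apply: IH.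
Qed.

Lemma pbin_expectD ps f (c : R) :
  pbin_expect ps (fun m => f m + c) = pbin_expect ps f + c.
Proof.
by elim: ps f => [|p ps IH] f //=; rewrite (IH (fun m => f m.+1)) IH; ring.
Qed.

Lemma eq_pbin_expect ps f g : f =1 g -> pbin_expect ps f = pbin_expect ps g.
Proof. by move=> fg; congr pbin_expect; apply/funext. Qed.

(** Lindeberg replacement by induction: the induction hypothesis at [y] and [y - 1] replaces all
    variables but the first, and [std_cdf_bernoulli] with step [1 / sqrt (t + V)] moves [p] into the
    mean and [p * (1 - p)] into the variance. The initial variance [t] keeps every step below
    [1 / sqrt t]. *)
Lemma pbin_lindeberg ps (t y : R) : is_params ps -> 1 <= t ->
  `|pbin_expect ps (fun m => std_cdf ((y - m%:R) / Num.sqrt t))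
    - std_cdf ((y - pbin_mean ps) / Num.sqrt (t + pbin_var ps))|
  <= 200 * (Num.sqrt t)^-1 ^+ 3 * pbin_mean ps.
Proof.
move=> hps t1; elim: ps y hps => [|p ps IH] y.
  by rewrite /pbin_mean /pbin_var !big_nil/= addr0 subrr normr0 mulr0.
move=> /= /andP[/andP[p0 p1] hps].
have := IH (y - 1) hps; have := IH y hps.
have mE : pbin_mean (p :: ps) = p + pbin_mean ps by rewrite /pbin_mean big_cons.
have vE : pbin_var (p :: ps) = p * (1 - p) + pbin_var ps.
  by rewrite /pbin_var big_cons.
rewrite mE vE.
set M := pbin_mean ps; set V := pbin_var ps; set h := (Num.sqrt t)^-1.
rewrite (_ : (fun m : nat => std_cdf ((y - 1 - m%:R) / Num.sqrt t)) =
  (fun m : nat => std_cdf ((y - m.+1%:R) / Num.sqrt t))); last first.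
  apply/funext => m; rewrite -natr1.
  by rewrite (_ : y - 1 - m%:R = y - (m%:R + 1)) //; ring.
set E0 := pbin_expect ps _; set E1 := pbin_expect ps _ => H0 H1.
have V0 : 0 <= V by exact: pbin_var_ge0.
have tV : 1 <= t + V by rewrite (le_trans t1)// lerDl.
pose r := Num.sqrt (t + V).
have r0 : 0 < r by rewrite sqrtr_gt0 (lt_le_trans _ tV).
have t0 : 0 < Num.sqrt t by rewrite sqrtr_gt0 (lt_le_trans _ t1).
have rh : r^-1 <= h by rewrite lef_pV2 ?posrE// ler_wsqrtr// lerDl.
have r1 : r^-1 <= 1.
  by rewrite invf_le1// -[leLHS]sqrtr1 ler_wsqrtr.
have p01 : 0 <= p <= 1 by rewrite p0.
have r01 : 0 <= r^-1 <= 1 by rewrite invr_ge0 (ltW r0).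
have := std_cdf_bernoulli ((y - M) / r) p r^-1 p01 r01.
have -> : (y - M) / r - r^-1 = (y - 1 - M) / r by field; rewrite gt_eqF.
have -> : ((y - M) / r - p * r^-1) / Num.sqrt (1 + p * (1 - p) * r^-1 ^+ 2) =
    (y - (p + M)) / Num.sqrt (t + (p * (1 - p) + V)).
  have -> : t + (p * (1 - p) + V) = r ^+ 2 * (1 + p * (1 - p) * r^-1 ^+ 2).
    have r2 : t = r ^+ 2 - V by rewrite sqr_sqrtr ?addrK// (le_trans _ tV).
    by rewrite {1}r2; field; rewrite gt_eqF.
  rewrite sqrtrM ?sqr_ge0// sqrtr_sqr gtr0_norm//.
  have : 0 < Num.sqrt (1 + p * (1 - p) * r^-1 ^+ 2).
    rewrite sqrtr_gt0 ltr_pwDl// mulr_ge0 ?sqr_ge0//.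
    by rewrite mulr_ge0// subr_ge0.
  set s := Num.sqrt _ => s0; field; by rewrite !gt_eqF.
rewrite -/r in H0 H1 *.
set A0 := std_cdf _ in H0 *; set A1 := std_cdf _ in H1 *; set B := std_cdf _.
move=> HB.
have hB : 200 * r^-1 ^+ 3 * p <= 200 * h ^+ 3 * p.
  have h0 : 0 <= h by rewrite invr_ge0 ltW.
  by rewrite ler_wpM2r// ler_wpM2l// lerXn2r// nnegrE invr_ge0 ltW.
rewrite (_ : _ - B = p * (E1 - A1) + ((1 - p) * (E0 - A0) +
  (p * A1 + (1 - p) * A0 - B))); last by ring.
rewrite (_ : _ * (p + M) = p * (200 * h ^+ 3 * M) +
  ((1 - p) * (200 * h ^+ 3 * M) + 200 * h ^+ 3 * p)); last by ring.
apply: (le_trans (ler_normD _ _)); apply: lerD.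
  by rewrite normrM ger0_norm// ler_wpM2l.
apply: (le_trans (ler_normD _ _)); apply: lerD; last exact: le_trans hB.
by rewrite normrM ger0_norm ?subr_ge0// ler_wpM2l// subr_ge0.
Qed.

Definition pbin_lt ps (d : nat) : R := pbin_expect ps (fun m => (m < d)%N%:R).

Lemma pbin_lt_ge0 ps d : is_params ps -> 0 <= pbin_lt ps d.
Proof.
move=> hps; have cst0 : pbin_expect ps (fun=> 0) = 0.
  by elim: ps {hps} => //= p ps ->; rewrite !mulr0 addr0.
by rewrite -cst0; apply: pbin_expect_le.
Qed.

Lemma pbin_lt_le1 ps d : is_params ps -> pbin_lt ps d <= 1.
Proof.
move=> hps; have cst1 : pbin_expect ps (fun=> 1) = 1.
  by elim: ps {hps} => //= p ps ->; ring.
by rewrite -[leRHS]cst1; apply: pbin_expect_le => // m; case: ltnP.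
Qed.

(** The indicator of [m < d] is compared with a normal distribution function of width [s], shifted
    by [K * s]: for [m < d] its value is at least [std_cdf K], and for [m >= d] nonnegativity
    suffices. *)
Lemma pbin_lt_upper ps d (s K : R) : is_params ps -> 1 <= s ->
  pbin_lt ps d <=
  std_cdf ((d%:R + K * s - pbin_mean ps) / Num.sqrt (s ^+ 2 + pbin_var ps))
  + (200 * s^-1 ^+ 3 * pbin_mean ps + (1 - std_cdf K)).
Proof.
move=> hps s1; have s0 : 0 < s by exact: lt_le_trans s1.
have t1 : 1 <= s ^+ 2 by rewrite exprn_ege1.
have := @pbin_lindeberg ps (s ^+ 2) (d%:R + K * s) hps t1.
rewrite sqrtr_sqr (gtr0_norm s0) => H'.
have := le_trans (ler_norm _) H'.
suff : pbin_lt ps d + (std_cdf K - 1) <=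
    pbin_expect ps (fun m => std_cdf ((d%:R + K * s - m%:R) / s)) by lra.
rewrite -pbin_expectD; apply: pbin_expect_le => // m.
have [md|dm] := ltnP m d; last first.
  by rewrite add0r (le_trans _ (std_cdf_ge0 _))// subr_le0 std_cdf_le1.
rewrite addrC subrK; apply: std_cdf_mono.
by rewrite ler_pdivlMr// [leRHS]addrAC lerDr subr_ge0 ler_nat ltnW.
Qed.

(** The opposite shift makes the smoothed indicator at most [std_cdf (- K)] for [m >= d]. *)
Lemma pbin_lt_lower ps d (s K : R) : is_params ps -> 1 <= s ->
  std_cdf ((d%:R - K * s - pbin_mean ps) / Num.sqrt (s ^+ 2 + pbin_var ps))
  - (200 * s^-1 ^+ 3 * pbin_mean ps + std_cdf (- K)) <= pbin_lt ps d.
Proof.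
move=> hps s1; have s0 : 0 < s by exact: lt_le_trans s1.
have t1 : 1 <= s ^+ 2 by rewrite exprn_ege1.
have := @pbin_lindeberg ps (s ^+ 2) (d%:R - K * s) hps t1.
rewrite sqrtr_sqr (gtr0_norm s0) distrC => H'.
have := le_trans (ler_norm _) H'.
suff : pbin_expect ps (fun m => std_cdf ((d%:R - K * s - m%:R) / s)) <=
    pbin_lt ps d + std_cdf (- K) by lra.
rewrite -pbin_expectD; apply: pbin_expect_le => // m.
have [md|dm] := ltnP m d.
  by rewrite (le_trans (std_cdf_le1 _))// lerDl std_cdf_ge0.
rewrite add0r; apply: std_cdf_mono.
by rewrite ler_pdivrMr// mulNr [leLHS]addrAC gerDr subr_le0 ler_nat.
Qed.
End PoissonBinomial.

(** * Generating functions of r-Stirling numbers *)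

Section StirlingGeneratingFunctions.
Context {R : realType}.
Implicit Types (r c : R) (Q : {poly R}).

Lemma coef_rising n m :
  (\prod_(j < n) ('X + (j%:R)%:P : {poly R}))`_m = (stirling1 n m)%:R.
Proof.
elim: n m => [|n IH] m.
  by rewrite big_ord0 coef1; case: m.
rewrite big_ord_recr/= mulrDr coefD coefMX coefMC !IH.
case: m => [|m] /=.
  by rewrite add0r -natrM; case: n {IH} => [|n]; rewrite ?muln0.
by rewrite natrD natrM; ring.
Qed.

Lemma size_rising n : size (\prod_(j < n) ('X + (j%:R)%:P : {poly R})) = n.+1.
Proof.
elim: n => [|n IH]; first by rewrite big_ord0 size_poly1.
rewrite big_ord_recr/= size_Mmonic ?monicXaddC//.
  by rewrite IH size_XaddC addn2.
by rewrite -size_poly_eq0 IH.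
Qed.

Lemma coef_XaddC_exp c n m :
  (('X + c%:P) ^+ n)`_m = 'C(n, m)%:R * c ^+ (n - m).
Proof.
rewrite addrC exprDn coef_sum.
under eq_bigr => i _ do rewrite coefMn -polyC_exp coefCM coefXn.
have [mn|nm] := leqP m n.
  rewrite (bigD1 (Ordinal (mn : (m < n.+1)%N)))//= eqxx mulr1.
  rewrite big1 ?addr0 ?mulr_natl//.
  move=> i /negPf im; rewrite [m == i](_ : _ = false) ?mulr0 ?mul0rn//.
  by apply/negbTE; move: im; rewrite -val_eqE/= eq_sym => ->.
rewrite bin_small// mul0r big1// => i _.
by rewrite gtn_eqF ?mulr0 ?mul0rn//; apply: leq_ltn_trans nm; rewrite -ltnS.
Qed.

(** Substituting ['X + r] into the rising factorial and expanding each power gives the defining sum;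
    terms with [j < m] vanish with their binomial coefficient. *)
Lemma coef_rising_shift r n m :
  (\prod_(j < n) ('X + (r + j%:R)%:P : {poly R}))`_m = rstirling1 r n m.
Proof.
have -> : \prod_(j < n) ('X + (r + j%:R)%:P : {poly R}) =
    (\prod_(j < n) ('X + (j%:R)%:P)) \Po ('X + r%:P).
  rewrite rmorph_prod/=; apply: eq_bigr => j _.
  by rewrite comp_polyD comp_polyX comp_polyC polyCD addrA.
rewrite comp_polyE coef_sum size_rising.
under eq_bigr => i _ do rewrite coefZ coef_rising coef_XaddC_exp mulrA.
rewrite /rstirling1 -(big_mkord xpredT
  (fun i => (stirling1 n i)%:R * 'C(i, m)%:R * r ^+ (i - m))).
have [mn|nm] := leqP m n.+1.
  rewrite (big_cat_nat _ (n := m))//= big_nat big1 ?add0r// => i /andP[_ im].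
  by rewrite bin_small// mulr0 mul0r.
rewrite [RHS]big_geq 1?ltnW// big_nat big1// => i /andP[_ im].
by rewrite bin_small ?mulr0 ?mul0r// (leq_trans im)// ltnW.
Qed.

Lemma coef_comp_scaleX Q c m : (Q \Po (c *: 'X))`_m = Q`_m * c ^+ m.
Proof.
rewrite comp_polyE coef_sum.
under eq_bigr => i _ do rewrite coefZ exprZn coefZ coefXn.
have [mn|nm] := ltnP m (size Q).
  rewrite (bigD1 (Ordinal mn))//= eqxx mulr1 big1 ?addr0//.
  move=> i /negPf im; rewrite [m == i](_ : _ = false) ?mulr0//.
  by apply/negbTE; move: im; rewrite -val_eqE/= eq_sym => ->.
rewrite nth_default// mul0r big1// => i _.
by rewrite gtn_eqF ?mulr0//; apply: leq_trans nm.
Qed.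

(** Induction on [m] through the recurrence. By [k.+1 * 'C(k, i) = (k.+1 - i) * 'C(k.+1, i)] the two
    sums share their terms, with weights [k.+1] and [- (k.+1 - i)] adding up to [i], the extra
    factor of the next power. *)
Lemma stirling2_explicit m k : (k`!)%:R * (stirling2 m k)%:R =
  \sum_(i < k.+1) (-1) ^+ (k - i) * 'C(k, i)%:R * (i%:R : R) ^+ m.
Proof.
elim: m k => [|m IH] k.
  under eq_bigr => i _ do rewrite expr0 mulr1.
  have <- : (0 : R) ^+ k = \sum_(i < k.+1) (-1) ^+ (k - i) * 'C(k, i)%:R.
    transitivity ((-1 + 1 : R) ^+ k); first by rewrite addNr.
    rewrite exprDn; apply: eq_bigr => i _.
    by rewrite expr1n mulr1 mulr_natr.
  by case: k => [|k]; rewrite ?expr0n/= ?mulr0// fact0 mulr1.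
case: k => [|k].
  by rewrite /= mulr0 big_ord1 expr0n/= mulr0.
have -> : (k.+1`!)%:R * (stirling2 m.+1 k.+1)%:R =
    k.+1%:R * ((k.+1`!)%:R * (stirling2 m k.+1)%:R)
    + k.+1%:R * ((k`!)%:R * (stirling2 m k)%:R) :> R.
  by rewrite factS /= natrD !natrM; ring.
rewrite !IH [in X in _ + X]mulr_sumr.
have -> : \sum_(i < k.+1) k.+1%:R *
      ((-1) ^+ (k - i) * 'C(k, i)%:R * (i%:R : R) ^+ m) =
    \sum_(i < k.+2) - ((-1) ^+ (k.+1 - i) * 'C(k.+1, i)%:R * (i%:R : R) ^+ m)
      * (k.+1 - i)%:R.
  rewrite [RHS]big_ord_recr/= subnn mulr0 addr0; apply: eq_bigr => i _.
  have ik : (i <= k)%N by rewrite -ltnS.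
  have /(congr1 (fun n => n%:R : R)) : (k.+1 * 'C(k, i) =
      (k.+1 - i) * 'C(k.+1, i))%N by rewrite mul_bin_down.
  rewrite !natrM subSn// exprS => E.
  rewrite (_ : k.+1%:R * _ = (-1) ^+ (k - i) * (k.+1%:R * 'C(k, i)%:R) *
    i%:R ^+ m); last by ring.
  by rewrite E; ring.
rewrite mulr_sumr -big_split/=; apply: eq_bigr => i _.
by rewrite natrB -1?ltnS// exprS; ring.
Qed.

(** The binomial theorem, after inserting [stirling2_explicit] and exchanging sums. *)
Lemma rstirling2_explicit r m k : (k`!)%:R * rstirling2 r m k =
  \sum_(i < k.+1) (-1) ^+ (k - i) * 'C(k, i)%:R * (i%:R + r) ^+ m.
Proof.
have -> : rstirling2 r m k =
    \sum_(j < m.+1) 'C(m, j)%:R * (stirling2 j k)%:R * r ^+ (m - j).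
  have st0 j : (j < k)%N -> stirling2 j k = 0%N.
    elim: j k => [|j IH] [|k]//= jk.
    by rewrite !IH// 1?ltnW// muln0.
  rewrite /rstirling2 -(big_mkord xpredT
    (fun j => 'C(m, j)%:R * (stirling2 j k)%:R * r ^+ (m - j))).
  have [mn|nm] := leqP k m.+1.
    rewrite [RHS](big_cat_nat _ (n := k))//= [X in _ = X + _]big1_seq ?add0r//.
    move=> i; rewrite mem_index_iota => /andP[_ im].
    by rewrite st0// mulr0 mul0r.
  rewrite [LHS]big_geq 1?ltnW// big1_seq// => i.
  rewrite mem_index_iota => /andP[_ im].
  by rewrite st0 ?mulr0 ?mul0r// (leq_trans im)// ltnW.
rewrite mulr_sumr.
under eq_bigr => j _ do
  rewrite mulrA mulrCA stirling2_explicit mulrC !mulr_sumr.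
rewrite exchange_big/=; apply: eq_bigr => i _.
rewrite addrC exprDn mulr_sumr; apply: eq_bigr => j _.
by rewrite -mulr_natl; ring.
Qed.
End StirlingGeneratingFunctions.

(** * The known probability as a combination of distribution functions *)

Section UniqueValue.
Context {R : realType}.
Implicit Types (ps : seq R) (Q : {poly R}).

Definition pbin_gf ps : {poly R} := \prod_(p <- ps) (p *: 'X + (1 - p)%:P).

Lemma pbin_lt_gf ps d : pbin_lt ps d = \sum_(m < d) (pbin_gf ps)`_m.
Proof.
rewrite /pbin_lt; elim: ps d => [|p ps IH] d.
  rewrite /pbin_gf big_nil/=; under eq_bigr do rewrite coef1.
  by case: d => [|d]; rewrite ?big_ord0// big_ord_recl big1 ?addr0.
rewrite /= IH /pbin_gf big_cons -/(pbin_gf ps).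
under [RHS]eq_bigr do rewrite mulrDl coefD -scalerAl coefZ coefXM coefCM.
rewrite big_split/= -!mulr_sumr; congr (_ * _ + _).
case: d => [|d].
  rewrite big_ord0 (_ : (fun _ => _) = fun=> 0); last by apply/funext.
  by elim: ps {IH} => //= q ps ->; rewrite !mulr0 addr0.
rewrite big_ord_recl/= add0r -IH.
by apply: eq_pbin_expect => m; rewrite ltnS.
Qed.

(** Passing from [d] to [d + 2] shifts [l] by one and adds the term [l = 0]; the last index
    [l = d + 1] fails the guard. *)
Lemma sum_parity_rec d (F : nat -> R) :
  \sum_(l < d.+2 | (2 * l < d.+2)%N) F (d.+2 - 2 * l - 1)%N =
  F d.+1 + \sum_(l < d | (2 * l < d)%N) F (d - 2 * l - 1)%N.
Proof.
rewrite big_mkcond big_ord_recl/= muln0/= subn0 subn1/=; congr (_ + _).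
rewrite big_ord_recr/= ifF ?addr0; last first.
  by rewrite /bump/= add1n mulnS !ltnS; apply/negbTE; rewrite -leqNgt; lia.
rewrite [RHS]big_mkcond/=; apply: eq_bigr => l _.
by rewrite /bump/= add1n mulnS !add2n !ltnS !subSS.
Qed.

(** Twice the coefficient of index [m] is the sum of the coefficients [m - 1] and [m] of [Q], so the
    indices [d - 1], [d - 3], and so on collect each coefficient below [d] exactly once. *)
Lemma sum_parity_half d Q :
  2 * \sum_(l < d | (2 * l < d)%N) ((2^-1 *: ('X + 1)) * Q)`_(d - 2 * l - 1) =
  \sum_(m < d) Q`_m.
Proof.
have coefH m : 2 * ((2^-1 *: ('X + 1)) * Q)`_m =
    (if m is m'.+1 then Q`_m' else 0) + Q`_m.
  rewrite -scalerAl coefZ mulVKf ?pnatr_eq0// mulrDl coefD mul1r coefXM.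
  by case: m.
(* The recursion steps by two, so [d] and [d + 1] are treated together. *)
suff H : forall d, 2 * \sum_(l < d | (2 * l < d)%N)
      ((2^-1 *: ('X + 1)) * Q)`_(d - 2 * l - 1) = \sum_(m < d) Q`_m /\
    2 * \sum_(l < d.+1 | (2 * l < d.+1)%N)
      ((2^-1 *: ('X + 1)) * Q)`_(d.+1 - 2 * l - 1) = \sum_(m < d.+1) Q`_m.
  by have [] := H d.
elim=> [|{}d [IH1 IH2]].
  split; first by rewrite !big_ord0 mulr0.
  by rewrite big_mkcond !big_ord1/= coefH add0r.
split=> //; rewrite (sum_parity_rec d (fun m => (_ : {poly R})`_m)).
by rewrite mulrDr IH1 coefH 2!big_ord_recr/=; ring.
Qed.

(** The factor [(i + 1/2) t + (j + 1/2)], divided by its value [i + j + 1] at [t = 1], generates a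
    Bernoulli trial with this parameter; [j = i] is treated apart. *)
Definition unique_params (i n : nat) : seq R :=
  [seq (i%:R + 2^-1) / (i + j).+1%:R | j <- iota 0 n & j != i].

Lemma unique_params_prob i n : is_params (unique_params i n).
Proof.
apply/allP => _ /mapP[j _ ->]; rewrite divr_ge0 ?addr_ge0 ?invr_ge0//=.
rewrite ler_pdivrMr ?ltr0n// mul1r -[leRHS]natr1 natrD.
by have : (0 : R) <= j%:R by []; lra.
Qed.

(* For [j = i] the parameter is 1/2, whose factor [(1 + 'X) / 2] turns the sum
   over indices of one parity into a distribution function. *)
Lemma rising_gf i n : (i < n)%N ->
  \prod_(j < n) ((i%:R + 2^-1 : R) *: 'X + (2^-1 + j%:R)%:P) =
  ((n + i)`!%:R / i`!%:R) *: ((2^-1 *: ('X + 1)) * pbin_gf (unique_params i n)).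
Proof.
move=> lin; rewrite -(big_mkord xpredT
  (fun j => (i%:R + 2^-1 : R) *: 'X + (2^-1 + j%:R)%:P)).
pose p j : R := (i%:R + 2^-1) / (i + j).+1%:R.
have fE j : (i%:R + 2^-1 : R) *: 'X + (2^-1 + j%:R)%:P =
    ((i + j).+1%:R)%:P * (p j *: 'X + (1 - p j)%:P).
  rewrite mulrDr -polyCM mul_polyC scalerA; congr (_ *: _ + _%:P).
    by rewrite /p mulrC divfK// pnatr_eq0.
  rewrite /p mulrBr mulr1 mulrC divfK ?pnatr_eq0//.
  by rewrite -[(i + j).+1%:R]natr1 natrD; field.
under eq_bigr => j _ do rewrite fE.
rewrite big_split/= -mul_polyC; congr (_ * _).
  (* The normalizers [i + j + 1] multiply to [(n + i)! / i!]. *)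
  rewrite -rmorph_prod/=; congr _%:P; rewrite big_mkord.
  apply: (mulIf (_ : i`!%:R != 0)); first by rewrite pnatr_eq0 -lt0n fact_gt0.
  rewrite divfK; last by rewrite pnatr_eq0 -lt0n fact_gt0.
  elim: n {lin} => [|m IH]; first by rewrite big_ord0 mul1r.
  by rewrite big_ord_recr/= mulrAC IH addSn factS natrM addnC mulrC.
rewrite /index_iota subn0 (bigD1_seq i) ?mem_iota ?iota_uniq//=; congr (_ * _).
  rewrite (_ : p i = 2^-1); last first.
    rewrite /p -[(i + i).+1%:R]natr1 natrD; have : (0 : R) <= i%:R by [].
    by move=> i0; field; rewrite gt_eqF//; lra.
  by rewrite (_ : 1 - 2^-1 = 2^-1) ?scalerDr -?mul_polyC ?mulr1//; field.
by rewrite /pbin_gf big_map big_filter.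
Qed.

(** Once [rstirling2] is expanded, the powers of [i + 1/2] rescale the variable in the generating
    function of [rstirling1]; [rising_gf] and [sum_parity_half] then turn the sum over [l] into
    [pbin_lt]. *)
Lemma unique_valueE k d n : (k < n)%N -> unique_value R k d n =
  \sum_(i < k.+1) (-1) ^+ (k - i) * 'C(k, i)%:R *
    ('C(n + i, i)%:R / 'C(n, k)%:R) * pbin_lt (unique_params i n) d.
Proof.
move=> kn; rewrite /unique_value.
have n0 : n`!%:R != 0 :> R by rewrite pnatr_eq0 -lt0n fact_gt0.
have c0 : 'C(n, k)%:R != 0 :> R by rewrite pnatr_eq0 -lt0n bin_gt0 ltnW.
rewrite (_ : 2 * k`!%:R / (n`!%:R * 'C(n, k)%:R) * _ =
  2 / (n`!%:R * 'C(n, k)%:R) * \sum_(l < d | (2 * l < d)%N)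
   rstirling1 2^-1 n (d - 2 * l - 1) *
   (k`!%:R * rstirling2 2^-1 (d - 2 * l - 1) k)); last first.
  rewrite [in RHS](eq_bigr (fun l : 'I_d => k`!%:R *
    (rstirling1 2^-1 n (d - 2 * l - 1) * rstirling2 2^-1 (d - 2 * l - 1) k))).
    by rewrite -mulr_sumr; ring.
  by move=> l _; rewrite mulrCA.
under eq_bigr => l _ do rewrite rstirling2_explicit mulr_sumr.
rewrite exchange_big/= mulr_sumr; apply: eq_bigr => i _.
(* This ensures that the factor [j = i], of parameter 1/2, occurs in the product. *)
have ik : (i < n)%N by apply: leq_trans kn; rewrite ltn_ord.
rewrite pbin_lt_gf -sum_parity_half.
set Q := (2^-1 *: ('X + 1)) * pbin_gf _.
have coefQ m : rstirling1 2^-1 n m * (i%:R + 2^-1) ^+ m =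
    (n + i)`!%:R / i`!%:R * Q`_m.
  rewrite -coefZ -rising_gf// -coef_rising_shift -coef_comp_scaleX.
  rewrite rmorph_prod/=; congr ((_ : {poly R})`_m); apply: eq_bigr => j _.
  by rewrite comp_polyD comp_polyX comp_polyC.
under eq_bigr => l _ do rewrite mulrCA coefQ mulrA.
rewrite -mulr_sumr.
have i0 : i`!%:R != 0 :> R by rewrite pnatr_eq0 -lt0n fact_gt0.
have -> : (n + i)`!%:R = 'C(n + i, i)%:R * i`!%:R * n`!%:R :> R.
  by rewrite -!natrM -(bin_fact (leq_addl n i)) addnK mulnA.
by field; rewrite n0 c0 i0.
Qed.
End UniqueValue.

(** * Asymptotics *)

Section MeanVariance.
Context {R : realType}.

Lemma ln_succ_le (m : nat) : (0 < m)%N ->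
  ln m.+1%:R - ln m%:R <= m%:R^-1 :> R.
Proof.
move=> m0; have m0R : (0 : R) < m%:R by rewrite ltr0n.
rewrite -ln_div ?posrE ?ltr0n//.
rewrite (_ : m.+1%:R / m%:R = 1 + m%:R^-1); last first.
  by rewrite -natr1 mulrDl divff ?gt_eqF// mul1r.
by rewrite le_ln1Dx// (lt_trans (_ : _ < 0)) ?invr_gt0// ltrN10.
Qed.

Lemma ln_succ_ge (m : nat) : (0 < m)%N ->
  m.+1%:R^-1 <= ln m.+1%:R - ln m%:R :> R.
Proof.
move=> m0; have m0R : (0 : R) < m%:R by rewrite ltr0n.
have m1R : (0 : R) < m.+1%:R by rewrite ltr0n.
rewrite -lerN2 opprB -ln_div ?posrE//.
rewrite (_ : m%:R / m.+1%:R = 1 + - m.+1%:R^-1); last first.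
  rewrite -[m.+1%:R]natr1; field.
  by rewrite gt_eqF// ltr_wpDl.
by rewrite le_ln1Dx// ltrN2 invf_lt1// ltr1n.
Qed.

Lemma harmonic_shift_le (k n : nat) : (0 < n)%N ->
  \sum_(j < n) (k + j).+1%:R^-1 <= 1 + ln n%:R :> R.
Proof.
elim: n => // -[_ _|n IH _].
  by rewrite big_ord1 ln1 addr0 invf_le1 ?ltr0n// ler1n.
rewrite big_ord_recr/=.
have Hn : (k + n.+1).+1%:R^-1 <= n.+2%:R^-1 :> R.
  by rewrite lef_pV2 ?posrE ?ltr0n// ler_nat ltnS leq_addl.
apply: (le_trans (lerD (IH isT) (le_trans Hn (ln_succ_ge n.+1 isT)))).
by rewrite -addrA [ln n.+1%:R + _]addrC subrK.
Qed.

Lemma harmonic_shift_ge (k n : nat) :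
  ln (k + n).+1%:R - ln k.+1%:R <= \sum_(j < n) (k + j).+1%:R^-1 :> R.
Proof.
elim: n => [|n IH]; first by rewrite big_ord0 addn0 subrr.
rewrite big_ord_recr/= addnS.
rewrite -(subrK (ln (k + n).+1%:R) (ln (k + n).+2%:R)) -addrA addrC.
exact: lerD IH (ln_succ_le (k + n).+1 isT).
Qed.

(** Telescoping: [1 / x^2 <= 2 / (x (x + 1)) = 2 / x - 2 / (x + 1)] for [x >= 1]. *)
Lemma sum_invsq_le (n : nat) :
  \sum_(j < n) (j.+1%:R^-1 : R) ^+ 2 <= 2 * (1 - n.+1%:R^-1).
Proof.
elim: n => [|n IH]; first by rewrite big_ord0 invr1 subrr mulr0.
rewrite big_ord_recr/=.
have n1 : (0 : R) < n.+1%:R by rewrite ltr0n.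
have n2 : n.+2%:R = n.+1%:R + 1 :> R by rewrite natr1.
have n3 : (1 : R) <= n.+1%:R by rewrite ler1n.
move: IH; rewrite n2; move: n1 n3; set x := n.+1%:R => x0 x1 IH.
have x2 : 0 < x + 1 by lra.
have -> : 1 - (x + 1)^-1 = 1 - x^-1 + (x * (x + 1))^-1.
  by field; rewrite !gt_eqF.
rewrite mulrDr lerD// exprVn -ler_pdivrMl// mulrC -invfM.
rewrite lef_pV2 ?posrE ?mulr_gt0 ?exprn_gt0//.
by nra.
Qed.

(** The mean is a multiple of a harmonic sum up to a constant, hence logarithmic; the variance
    differs from it by the sum of the squared parameters, which stays bounded. *)
Lemma unique_params_meanvar (k : nat) : exists C : R, forall n, (k < n)%N ->
  `|pbin_mean (@unique_params R k n) - (k%:R + 2^-1) * ln n%:R| <= C /\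
  `|pbin_var (@unique_params R k n) - (k%:R + 2^-1) * ln n%:R| <= C.
Proof.
set th := k%:R + 2^-1 : R; have k0 : (0 : R) <= k%:R by [].
have th0 : 0 < th by rewrite /th; lra.
(* The three terms cover the harmonic error, the omitted trial of parameter 1/2, and the sum of
   squares. *)
exists (th * (1 + ln k.+1%:R) + 1 + 2 * th ^+ 2) => n kn.
have n0 : (0 < n)%N by exact: leq_ltn_trans kn.
have lnk : (0 : R) <= ln k.+1%:R by rewrite ln_ge0// ler1n.
have th2 : 0 <= th ^+ 2 by exact: sqr_ge0.
have thl : 0 <= th * ln k.+1%:R by rewrite mulr_ge0// ltW.
set ps := unique_params k n.
have mE : pbin_mean ps =
    th * (\sum_(j < n) (k + j).+1%:R^-1) - 2^-1.
  rewrite /pbin_mean /ps /unique_params big_map big_filter mulr_sumr.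
  rewrite -(big_mkord xpredT (fun j => th * (k + j).+1%:R^-1)).
  rewrite /index_iota subn0.
  rewrite [X in _ = X - _](bigD1_seq k) ?mem_iota ?iota_uniq//=.
  have -> : th / (k + k).+1%:R = 2^-1.
    have k1 : (k%:R + k%:R + 1 : R) != 0 by rewrite gt_eqF//; lra.
    by rewrite /th -[(k + k).+1%:R]natr1 natrD; field.
  by rewrite addrAC subrr add0r.
have mvE : pbin_var ps = pbin_mean ps -
    \sum_(q <- ps) q ^+ 2.
  by rewrite /pbin_var /pbin_mean -sumrB; apply: eq_bigr => q _; ring.
have sq0 : 0 <= \sum_(q <- ps) q ^+ 2.
  by rewrite sumr_ge0// => q _; exact: sqr_ge0.
have sq1 : \sum_(q <- ps) q ^+ 2 <= 2 * th ^+ 2.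
  apply: (@le_trans _ _ (\sum_(j < n) th ^+ 2 * (j.+1%:R^-1 : R) ^+ 2)).
    rewrite /ps /unique_params big_map big_filter.
    rewrite -(big_mkord xpredT (fun j => th ^+ 2 * (j.+1%:R^-1 : R) ^+ 2)).
    rewrite /index_iota subn0 big_mkcond/=; apply: ler_sum => j _.
    case: ifP => _; last by rewrite mulr_ge0// sqr_ge0.
    rewrite exprMn ler_wpM2l// lerXn2r ?nnegrE ?invr_ge0//.
    by rewrite lef_pV2 ?posrE ?ltr0n// ler_nat ltnS leq_addl.
  rewrite -mulr_sumr mulrC ler_wpM2r//; apply: (le_trans (sum_invsq_le n)).
  by rewrite ler_piMr// gerBl invr_ge0.
have S1 : th * (\sum_(j < n) (k + j).+1%:R^-1) <= th * (1 + ln n%:R).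
  by rewrite ler_wpM2l ?(ltW th0)// harmonic_shift_le.
have S2 : th * (ln n%:R - ln k.+1%:R) <=
    th * (\sum_(j < n) (k + j).+1%:R^-1).
  rewrite ler_wpM2l ?(ltW th0)// (le_trans _ (harmonic_shift_ge k n))//.
  rewrite lerD2r ler_ln ?posrE ?ltr0n// ler_nat.
  by rewrite (leq_trans (leq_addl k n)).
move: S1 S2; rewrite mvE mE mulrBr !mulrDr mulr1.
move: thl sq0 sq1 th2 (ltW th0); set a := th * ln n%:R.
set b := th * ln k.+1%:R; set c := th * bigop.body _ _ _.
set e := \sum_(q <- ps) _.
set t := th ^+ 2 => thl sq0 sq1 th2 th1 S1 S2.
by rewrite !ler_norml; split; apply/andP; split; lra.
Qed.
End MeanVariance.

(** * Limits of the weights in the alternating sum *)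

Section Weights.
Context {R : realType}.

Lemma cvg_natrV : (m%:R^-1 : R) @[m --> \oo] --> (0 : R).
Proof.
apply/gtr0_cvgV0; last exact: cvgr_idn.
by near=> m; rewrite ltr0n; near: m; exact: nbhs_infty_gt.
Unshelve. all: by end_near. Qed.

Lemma cvg_expr (u : nat -> R) (a : R) b : u d @[d --> \oo] --> a ->
  u d ^+ b @[d --> \oo] --> a ^+ b.
Proof.
move=> ua; elim: b => [|b IH].
  by under eq_cvg do rewrite expr0; rewrite expr0; exact: cvg_cst.
by under eq_cvg do rewrite exprS; rewrite exprS; exact: cvgM.
Qed.

Lemma cvg_ffact a b :
  (((m + a) ^_ b)%:R / m%:R ^+ b : R) @[m --> \oo] --> (1 : R).
Proof.
elim: b => [|b IH].
  by apply: cvg_near_cst; near=> m; rewrite ffactn0 expr0 divr1.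
have H : (((m + a) ^_ b)%:R / m%:R ^+ b * (1 + (a%:R - b%:R) * m%:R^-1) : R)
    @[m --> \oo] --> (1 * (1 + (a%:R - b%:R) * 0) : R).
  apply: cvgM => //; apply: cvgD; first exact: cvg_cst.
  by apply: cvgM; [exact: cvg_cst|exact: cvg_natrV].
rewrite mulr0 addr0 mulr1 in H; apply: cvg_trans H; apply: near_eq_cvg.
near=> m; have mb : (b <= m)%N by near: m; exact: nbhs_infty_ge.
have m0 : (0 : R) < m%:R by rewrite ltr0n; near: m; exact: nbhs_infty_gt.
rewrite ffactnSr natrM natrB ?(leq_trans mb) ?leq_addr// natrD exprS.
by field; rewrite ?expf_neq0 ?lt0r_neq0.
Unshelve. all: by end_near. Qed.

(** In terms of falling factorials the ratio is [k! / i!] times [m^(i - k)], up to a factor tending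
    to 1. *)
Lemma cvg_bin_ratio i k : (i <= k)%N ->
  ('C(m + i, i)%:R / 'C(m, k)%:R : R) @[m --> \oo] --> ((i == k)%:R : R).
Proof.
move=> ik.
have H : ((k`!%:R / i`!%:R) *
    ((((m + i) ^_ i)%:R / m%:R ^+ i) / (((m + 0) ^_ k)%:R / m%:R ^+ k)) *
    m%:R^-1 ^+ (k - i) : R)
    @[m --> \oo] --> ((k`!%:R / i`!%:R) * (1 / 1) * 0 ^+ (k - i) : R).
  apply: cvgM; last by apply: cvg_expr; exact: cvg_natrV.
  apply: cvgM; first exact: cvg_cst.
  apply: cvgM; first exact: cvg_ffact.
  by apply: cvgV; [exact: oner_neq0|exact: cvg_ffact].
rewrite (_ : _ * 0 ^+ _ = (i == k)%:R) in H; last first.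
  rewrite divr1 mulr1 expr0n subn_eq0 eqn_leq ik/=.
  have [ki|] := leqP k i; last by rewrite mulr0.
  have -> : i = k by apply/eqP; rewrite eqn_leq ik.
  by rewrite mulr1 divff// pnatr_eq0 -lt0n fact_gt0.
apply: cvg_trans H; apply: near_eq_cvg; near=> m.
have m0 : (0 : R) < m%:R by rewrite ltr0n; near: m; exact: nbhs_infty_gt.
have km : (k <= m)%N by near: m; exact: nbhs_infty_ge.
rewrite addn0 -!bin_ffact !natrM.
have i0 : i`!%:R != 0 :> R by rewrite pnatr_eq0 -lt0n fact_gt0.
have k0 : k`!%:R != 0 :> R by rewrite pnatr_eq0 -lt0n fact_gt0.
have c0 : 'C(m, k)%:R != 0 :> R by rewrite pnatr_eq0 -lt0n bin_gt0.
have -> : m%:R ^+ k = m%:R ^+ (k - i) * m%:R ^+ i :> R by rewrite -exprD subnK.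
rewrite exprVn; field; rewrite i0 k0 c0 !expf_neq0//; exact: lt0r_neq0.
Unshelve. all: by end_near. Qed.

Lemma cvg_bounded_mul0 (e u : nat -> R) (C : R) :
  (\forall d \near \oo, `|e d| <= C) -> u d @[d --> \oo] --> (0 : R) ->
  e d * u d @[d --> \oo] --> (0 : R).
Proof.
move=> eC u0; apply/norm_cvg0P.
apply: (@squeeze_cvgr _ _ _ _ (fun=> 0) (fun d => C * `|u d|)).
- near=> d; rewrite normr_ge0/= normrM ler_wpM2r//.
  by near: d; exact: eC.
- exact: cvg_cst.
- rewrite -(mulr0 C); apply: cvgM; first exact: cvg_cst.
  exact/norm_cvg0P.
Unshelve. all: by end_near. Qed.

(** For [i < k] a vanishing weight multiplies a probability, which is bounded; for [i = k] the
    weight tends to 1. *)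
Lemma cvg_unique_value k (n : nat -> nat) (l : R) :
  (forall d, (d <= n d)%N) ->
  pbin_lt (unique_params k (n d)) d @[d --> \oo] --> l ->
  unique_value R k d (n d) @[d --> \oo] --> l.
Proof.
move=> dn Hl.
have noo : n @ \oo --> \oo.
  move=> A [N _ NA]; exists N => // d /= Nd; apply: NA => /=.
  exact: leq_trans (dn d).
have wlim i : (i <= k)%N ->
    ('C(n d + i, i)%:R / 'C(n d, k)%:R : R) @[d --> \oo] --> ((i == k)%:R : R).
  by move=> ik; apply: (cvg_comp _ _ noo (cvg_bin_ratio i k ik)).
have H : \sum_(i < k.+1) (-1) ^+ (k - i) * 'C(k, i)%:R *
    ('C(n d + i, i)%:R / 'C(n d, k)%:R) * pbin_lt (unique_params i (n d)) d
    @[d --> \oo] --> l.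
  under eq_cvg do rewrite big_ord_recr/= subnn expr0 binn !mul1r.
  rewrite -[l]add0r; apply: cvgD; last first.
    rewrite -[l]mul1r; apply: cvgM => //.
    by have := wlim k (leqnn k); rewrite eqxx.
  have -> : (fun d => \sum_(i < k) (-1) ^+ (k - i) * 'C(k, i)%:R *
    ('C(n d + i, i)%:R / 'C(n d, k)%:R) * pbin_lt (unique_params i (n d)) d) =
    \sum_(i < k) (fun d => (-1) ^+ (k - i) * 'C(k, i)%:R *
      ('C(n d + i, i)%:R / 'C(n d, k)%:R) *
      pbin_lt (unique_params i (n d)) d : R).
    by apply/funext => d; rewrite fct_sumE.
  elim/big_ind: _ => [|f g f0 g0|i _].
  - exact: cvg_cst.
  - by rewrite -[0 : R](addr0 0); exact: cvgD.
  - under eq_cvg do rewrite mulrC.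
    apply: (@cvg_bounded_mul0 _ _ 1).
      near=> d; rewrite ger0_norm ?pbin_lt_ge0 ?pbin_lt_le1//;
      exact: unique_params_prob.
    rewrite -(mulr0 ((-1) ^+ (k - i) * 'C(k, i)%:R)); apply: cvgM.
      exact: cvg_cst.
    have := wlim i (ltnW (ltn_ord i)); rewrite (_ : (i == k :> nat) = false)//.
    by apply/negbTE; rewrite neq_ltn ltn_ord.
apply: cvg_trans H; apply: near_eq_cvg; near=> d.
rewrite unique_valueE//; apply: leq_trans (dn d).
by near: d; exact: nbhs_infty_gt.
Unshelve. all: by end_near. Qed.
End Weights.

(** * Asymptotic normality of the number of successes *)

Section CentralLimit.
Context {R : realType}.

(** With [u = L^(-1/16)] every scale in the smoothing argument is an integer power of [u]: [sqrt L]
    is [u^(-8)] and the window is [u^(-6)]. *)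
Lemma cvg_root_inv (L : nat -> R) : L d @[d --> \oo] --> +oo ->
  exists2 u : nat -> R, u d @[d --> \oo] --> (0 : R) &
    \forall d \near \oo, 0 < u d /\ L d * u d ^+ 16 = 1.
Proof.
move=> Loo; pose s d := L d `^ 16^-1.
have L0 : \forall d \near \oo, 0 < L d.
  move/cvgryPge : Loo => /(_ 1); apply: filterS => d; exact: lt_le_trans.
have s0 : \forall d \near \oo, 0 < s d.
  by apply: filterS L0 => d Ld; rewrite powR_gt0.
have s16 : \forall d \near \oo, s d ^+ 16 = L d.
  apply: filterS L0 => d Ld; rewrite /s -powR_mulrn ?powR_ge0// -powRrM.
  by rewrite mulVf// powRr1// ltW.
exists (fun d => (s d)^-1).
  apply/gtr0_cvgV0 => //; apply/cvgryPge => A.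
  move/cvgryPge : Loo => /(_ (`|A| ^+ 16)) LA; near=> d.
  apply: (le_trans (ler_norm A)).
  rewrite -(@ler_pXn2r _ 16) ?nnegrE ?powR_ge0//.
  rewrite (near s16 d)//; near: d; exact: LA.
near=> d; have sd : 0 < s d by near: d; exact: s0.
split; first by rewrite invr_gt0.
by rewrite -(near s16 d)// exprVn divff// expf_neq0// lt0r_neq0.
Unshelve. all: by end_near. Qed.

Variables (ps : nat -> seq R) (L : nat -> R) (C : R).
Hypothesis params : forall d, is_params (ps d).
Hypothesis Loo : L d @[d --> \oo] --> +oo.
Hypothesis mean_near : \forall d \near \oo, `|pbin_mean (ps d) - L d| <= C.
Hypothesis var_near : \forall d \near \oo, `|pbin_var (ps d) - L d| <= C.

Let z d : R := (d%:R - L d) / Num.sqrt (L d).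

(* The window [s = L ^ (6/16)] used for smoothing the indicator satisfies both
   [L ^ (1/3) << s], so that the Lindeberg error vanishes, and
   [s << L ^ (1/2)], so that the smoothing itself is negligible. *)
Lemma pbin_lt_sandwich : exists b1 b2 r e1 e2 : nat -> R,
  [/\ b1 d @[d --> \oo] --> (0 : R), b2 d @[d --> \oo] --> (0 : R),
      r d @[d --> \oo] --> (1 : R),
      e1 d @[d --> \oo] --> (0 : R) & e2 d @[d --> \oo] --> (0 : R)] /\
  \forall d \near \oo,
    std_cdf ((z d + b1 d) / r d) - e1 d <= pbin_lt (ps d) d <=
    std_cdf ((z d + b2 d) / r d) + e2 d.
Proof.
have [u u0 uL] := cvg_root_inv L Loo.
pose eM d := pbin_mean (ps d) - L d.
pose eV d := pbin_var (ps d) - L d.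
have un m : (0 < m)%N -> u d ^+ m @[d --> \oo] --> (0 : R).
  by move=> m0; have := cvg_expr u 0 m u0; rewrite expr0n gtn_eqF.
have eMu m : (0 < m)%N -> eM d * u d ^+ m @[d --> \oo] --> (0 : R).
  by move=> m0; apply: (@cvg_bounded_mul0 _ _ _ C) => //; exact: un.
have eVu m : (0 < m)%N -> eV d * u d ^+ m @[d --> \oo] --> (0 : R).
  by move=> m0; apply: (@cvg_bounded_mul0 _ _ _ C) => //; exact: un.
have uy : (u d)^-1 @[d --> \oo] --> +oo.
  by apply/cvgrVy => //; apply: filterS uL => d [].
(* With window [s = u^(-6)] and cutoff [K = 1 / u]: [r] is the smoothed standard deviation divided
   by [sqrt L], [b1] and [b2] combine the error of the mean with the shift [K s / sqrt L = u], and
   [e] is the Lindeberg error [200 s^(-3)] times the mean. *)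
pose r d := Num.sqrt (u d ^+ 4 + 1 + eV d * u d ^+ 16).
pose b1 d := - (eM d * u d ^+ 8) - u d.
pose b2 d := - (eM d * u d ^+ 8) + u d.
pose e d := 200 * (u d ^+ 2 + eM d * u d ^+ 18).
exists b1, b2, r, (fun d => e d + std_cdf (- (u d)^-1)),
  (fun d => e d + (1 - std_cdf (u d)^-1)).
have e0 : e d @[d --> \oo] --> (0 : R).
  rewrite -(mulr0 200) -[X in 200 * X](addr0 0).
  apply: cvgM; first exact: cvg_cst.
  by apply: cvgD; [exact: un|exact: eMu].
have N0 : - (eM d * u d ^+ 8) @[d --> \oo] --> (0 : R).
  by rewrite -oppr0; apply: cvgN; exact: eMu.
split; first split.
- by rewrite -(subr0 0); apply: cvgB.
- by rewrite -(addr0 0); apply: cvgD.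
- have H : u d ^+ 4 + 1 + eV d * u d ^+ 16 @[d --> \oo] --> (0 + 1 + 0 : R).
    apply: cvgD; last exact: eVu.
    by apply: cvgD; [exact: un|exact: cvg_cst].
  rewrite add0r addr0 in H; rewrite -(sqrtr1 R).
  exact: (cvg_comp _ _ H (@sqrt_continuous R 1)).
- rewrite -(addr0 0); apply: cvgD => //.
  apply: (cvg_comp _ _ _ cvg_std_cdfNy).
  exact/cvgNrNy.
- rewrite -(addr0 0); apply: cvgD => //.
  rewrite -(subrr 1); apply: cvgB; first exact: cvg_cst.
  exact: (cvg_comp _ _ uy cvg_std_cdfy).
near=> d.
have [ud Lu] : 0 < u d /\ L d * u d ^+ 16 = 1 by near: d; exact: uL.
have u1 : u d <= 1.
  apply: le_trans (ler_norm _) _; near: d.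
  by move/cvgr0Pnorm_le : u0; apply.
have ui : u d != 0 by rewrite lt0r_neq0.
have LE : L d = (u d)^-1 ^+ 16.
  rewrite exprVn; apply: (mulIf (expf_neq0 16 ui)).
  by rewrite Lu mulVf// expf_neq0.
have sqL : Num.sqrt (L d) = (u d)^-1 ^+ 8.
  rewrite LE (_ : _ ^+ 16 = ((u d)^-1 ^+ 8) ^+ 2); last by rewrite -exprM.
  by rewrite sqrtr_sqr ger0_norm// exprn_ge0// invr_ge0 ltW.
have s1 : 1 <= (u d)^-1 ^+ 6.
  by rewrite exprn_ege1// -[leLHS]invr1 lef_pV2 ?posrE.
have dE : d%:R = z d * (u d)^-1 ^+ 8 + (u d)^-1 ^+ 16.
  by rewrite /z sqL -LE divfK ?subrK// expf_neq0// invr_eq0.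
have ME : pbin_mean (ps d) = eM d + (u d)^-1 ^+ 16 by rewrite /eM -LE subrK.
have VE : pbin_var (ps d) = eV d + (u d)^-1 ^+ 16 by rewrite /eV -LE subrK.
have rE : Num.sqrt ((u d)^-1 ^+ 6 ^+ 2 + pbin_var (ps d)) = (u d)^-1 ^+ 8 * r d.
  rewrite /r -[X in X * _]ger0_norm; last by rewrite exprn_ge0// invr_ge0 ltW.
  rewrite -sqrtr_sqr -sqrtrM ?sqr_ge0//; congr Num.sqrt.
  by rewrite VE; field.
have argE b B : d%:R + B - pbin_mean (ps d) = (u d)^-1 ^+ 8 * (z d + b) ->
    (d%:R + B - pbin_mean (ps d)) /
      Num.sqrt ((u d)^-1 ^+ 6 ^+ 2 + pbin_var (ps d)) = (z d + b) / r d.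
  move=> ->; rewrite rE invfM mulrACA divff ?mul1r// expf_neq0//.
  by rewrite invr_eq0.
have eE : 200 * ((u d)^-1 ^+ 6)^-1 ^+ 3 * pbin_mean (ps d) = e d.
  by rewrite ME /e; field.
apply/andP; split.
- have := @pbin_lt_lower _ (ps d) d ((u d)^-1 ^+ 6) (u d)^-1 (params d) s1.
  by rewrite (argE (b1 d) (- _)) ?eE// ME dE /b1; field.
- have := @pbin_lt_upper _ (ps d) d ((u d)^-1 ^+ 6) (u d)^-1 (params d) s1.
  by rewrite (argE (b2 d)) ?eE// ME dE /b2; field.
Unshelve. all: by end_near. Qed.

Lemma cvg_pbin_lt (x : R) : z d @[d --> \oo] --> x ->
  pbin_lt (ps d) d @[d --> \oo] --> std_cdf x.
Proof.
move=> zx; have [b1 [b2 [r [e1 [e2 [[b10 b20 r1 e10 e20] H]]]]]] :=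
  pbin_lt_sandwich.
have lim b : b d @[d --> \oo] --> (0 : R) ->
    std_cdf ((z d + b d) / r d) @[d --> \oo] --> std_cdf x.
  move=> b0; have zb : (z d + b d) / r d @[d --> \oo] --> ((x + 0) / 1 : R).
    apply: cvgM; first exact: cvgD.
    by apply: cvgV => //; exact: oner_neq0.
  rewrite divr1 addr0 in zb.
  exact: (cvg_comp _ _ zb (continuous_std_cdf x)).
apply: (squeeze_cvgr H).
  by rewrite -[std_cdf x]subr0; apply: cvgB => //; exact: lim.
by rewrite -[std_cdf x]addr0; apply: cvgD => //; exact: lim.
Qed.

Lemma cvg_pbin_lty : z d @[d --> \oo] --> +oo ->
  pbin_lt (ps d) d @[d --> \oo] --> (1 : R).
Proof.
move=> zy; have [b1 [b2 [r [e1 [e2 [[b10 b20 r1 e10 e20] H]]]]]] :=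
  pbin_lt_sandwich.
apply: (@squeeze_cvgr _ _ _ _
  (fun d => std_cdf ((z d + b1 d) / r d) - e1 d) (fun=> 1)).
- near=> d; rewrite pbin_lt_le1// andbT.
  have /andP[] : std_cdf ((z d + b1 d) / r d) - e1 d <= pbin_lt (ps d) d <=
    std_cdf ((z d + b2 d) / r d) + e2 d by near: d; exact: H.
  by [].
- rewrite -[1 : R]subr0; apply: cvgB => //.
  apply: (cvg_comp _ _ _ cvg_std_cdfy); apply/cvgryPge => A.
  near=> d.
  have r2 : `|1 - r d| <= 2^-1 by near: d; apply: cvgr_dist_le => //; lra.
  have bd : `|b1 d| <= 1.
    by near: d; move/cvgr0Pnorm_le : b10; apply.
  (* As [r d <= 3/2] and [b1 d >= -1], this gives [A * r d <= z d + b1 d]. *)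
  have zd : 2 * `|A| + 1 <= z d by near: d; move/cvgryPge : zy; apply.
  move: r2 bd; rewrite !ler_norml => /andP[r2 r3] /andP[bd bd'].
  rewrite ler_pdivlMr; last by lra.
  by have := ler_norm A; have := normr_ge0 A; nra.
- exact: cvg_cst.
Unshelve. all: by end_near. Qed.

Lemma cvg_pbin_ltNy : z d @[d --> \oo] --> -oo ->
  pbin_lt (ps d) d @[d --> \oo] --> (0 : R).
Proof.
move=> zy; have [b1 [b2 [r [e1 [e2 [[b10 b20 r1 e10 e20] H]]]]]] :=
  pbin_lt_sandwich.
apply: (@squeeze_cvgr _ _ _ _ (fun=> 0)
  (fun d => std_cdf ((z d + b2 d) / r d) + e2 d)).
- near=> d; rewrite pbin_lt_ge0//=.
  have /andP[] : std_cdf ((z d + b1 d) / r d) - e1 d <= pbin_lt (ps d) d <=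
    std_cdf ((z d + b2 d) / r d) + e2 d by near: d; exact: H.
  by [].
- exact: cvg_cst.
- rewrite -[0 : R]addr0; apply: cvgD => //.
  apply: (cvg_comp _ _ _ cvg_std_cdfNy); apply/cvgrNyPle => A.
  near=> d.
  have r2 : `|1 - r d| <= 2^-1 by near: d; apply: cvgr_dist_le => //; lra.
  have bd : `|b2 d| <= 1.
    by near: d; move/cvgr0Pnorm_le : b20; apply.
  have zd : z d <= - (2 * `|A| + 1) by near: d; move/cvgrNyPle : zy; apply.
  move: r2 bd; rewrite !ler_norml => /andP[r2 r3] /andP[bd bd'].
  rewrite ler_pdivrMr; last by lra.
  by have := ler_norm (- A); rewrite normrN; have := normr_ge0 A; nra.
Unshelve. all: by end_near. Qed.
End CentralLimit.

(** * The standardized threshold in the three regimes *)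

Section Standardization.
Context {R : realType}.
Variable L : nat -> R.
Hypothesis Loo : L d @[d --> \oo] --> +oo.

Let sqrtL_large (A : R) : \forall d \near \oo, A <= Num.sqrt (L d).
Proof.
move/cvgryPge : Loo => /(_ (A ^+ 2)); apply: filterS => d LA.
by rewrite (le_trans (ler_norm A))// -sqrtr_sqr ler_wsqrtr.
Qed.

Let L_gt0 : \forall d \near \oo, 0 < L d.
Proof.
by move/cvgryPge : Loo => /(_ 1); apply: filterS => d; exact: lt_le_trans.
Qed.

(** The numerator is at least a positive multiple of [L], so the quotient is at least a positive
    multiple of [sqrt L]. *)
Lemma cvg_standardize_y (q : R) : q < 1 ->
  (\forall d \near \oo, L d <= q * d%:R) ->
  (d%:R - L d) / Num.sqrt (L d) @[d --> \oo] --> +oo.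
Proof.
(* [q] may be nonpositive; the maximum with 1/2 can be inverted and stays below 1. *)
move=> q1 HL; pose p := Num.max q 2^-1.
have p1 : p < 1 by rewrite gt_max q1/=; lra.
have p0 : 0 < p by rewrite lt_max orbC; apply/orP; left; lra.
have pi1 : 0 < p^-1 - 1 by rewrite subr_gt0 invf_gt1.
apply/cvgryPge => A; near=> d.
have Ld : 0 < L d by near: d; exact: L_gt0.
have s0 : 0 < Num.sqrt (L d) by rewrite sqrtr_gt0.
have sE : L d = Num.sqrt (L d) ^+ 2 by rewrite sqr_sqrtr// ltW.
have Lp : L d <= p * d%:R.
  apply: (@le_trans _ _ (q * d%:R)); first by near: d; exact: HL.
  by rewrite ler_wpM2r// le_max lexx.
have dL : p^-1 * L d <= d%:R by rewrite ler_pdivrMl.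
rewrite ler_pdivlMr//.
have sA : A / (p^-1 - 1) <= Num.sqrt (L d) by near: d; exact: sqrtL_large.
rewrite ler_pdivrMr// in sA.
apply: (@le_trans _ _ ((p^-1 - 1) * L d)); last by lra.
by rewrite [L d in leRHS]sE expr2 mulrA ler_pM2r// mulrC.
Unshelve. all: by end_near. Qed.

Lemma cvg_standardize_Ny (q : R) : 1 < q ->
  (\forall d \near \oo, q * d%:R <= L d) ->
  (d%:R - L d) / Num.sqrt (L d) @[d --> \oo] --> -oo.
Proof.
move=> q1 HL; have q0 : 0 < q by exact: lt_trans q1.
have qi1 : 0 < 1 - q^-1 by rewrite subr_gt0 invf_lt1.
apply/cvgrNyPle => A; near=> d.
have Ld : 0 < L d by near: d; exact: L_gt0.
have s0 : 0 < Num.sqrt (L d) by rewrite sqrtr_gt0.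
have sE : L d = Num.sqrt (L d) ^+ 2 by rewrite sqr_sqrtr// ltW.
have Lp : q * d%:R <= L d by near: d; exact: HL.
have dL : d%:R <= q^-1 * L d by rewrite ler_pdivlMl.
rewrite ler_pdivrMr//.
have sA : - A / (1 - q^-1) <= Num.sqrt (L d) by near: d; exact: sqrtL_large.
rewrite ler_pdivrMr// in sA.
apply: (@le_trans _ _ (- ((1 - q^-1) * L d))); first by lra.
rewrite [L d in leLHS]sE expr2 mulrA -mulNr ler_pM2r// lerNl mulrC.
exact: sA.
Unshelve. all: by end_near. Qed.
End Standardization.

(** Dividing numerator and denominator by [s = sqrt d] leaves [- (c + h / s)] over
    [sqrt (1 + (c + h / s) / s)]. *)
Lemma cvg_standardize_critical {R : realType} (L h : nat -> R) (c : R) :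
  h =o_\oo (fun d : nat => Num.sqrt (d%:R : R)) ->
  (forall d, L d = d%:R + c * Num.sqrt d%:R + h d) ->
  (d%:R - L d) / Num.sqrt (L d) @[d --> \oo] --> - c.
Proof.
move=> ho LE; pose s d : R := Num.sqrt d%:R.
have s0 : \forall d \near \oo, 0 < s d.
  by near=> d; rewrite sqrtr_gt0 ltr0n; near: d; exact: nbhs_infty_gt.
have hs : h d / s d @[d --> \oo] --> (0 : R).
  apply/cvgr0Pnorm_le => e e0; near=> d.
  have sd : 0 < s d by near: d; exact: s0.
  rewrite normrM normfV (gtr0_norm sd) ler_pdivrMr//.
  rewrite -[X in _ * X](gtr0_norm sd).
  by near: d; move/eqoP : ho; exact.
have si : (s d)^-1 @[d --> \oo] --> (0 : R).
  apply/gtr0_cvgV0 => //; apply/cvgryPge => A; near=> d.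
  rewrite (le_trans (ler_norm A))// -sqrtr_sqr ler_wsqrtr//.
  by near: d; apply: nbhs_infty_ger.
have num : - (c + h d / s d) @[d --> \oo] --> (- (c + 0) : R).
  by apply: cvgN; apply: cvgD => //; exact: cvg_cst.
have den : 1 + (c + h d / s d) * (s d)^-1
    @[d --> \oo] --> (1 + (c + 0) * 0 : R).
  apply: cvgD; first exact: cvg_cst.
  by apply: cvgM => //; apply: cvgD => //; exact: cvg_cst.
rewrite mulr0 addr0 in den; rewrite addr0 in num.
have sden := cvg_comp _ _ den (@sqrt_continuous R 1).
rewrite sqrtr1 in sden.
have quo : - (c + h d / s d) / Num.sqrt (1 + (c + h d / s d) * (s d)^-1)
    @[d --> \oo] --> (- c / 1 : R).
  by apply: cvgM => //; apply: cvgV => //; exact: oner_neq0.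
rewrite divr1 in quo.
apply: cvg_trans quo; apply: near_eq_cvg; near=> d => /=.
have sd : 0 < s d by near: d; exact: s0.
have dE : d%:R = s d ^+ 2 by rewrite sqr_sqrtr.
rewrite LE -/(s d) [in RHS]dE.
have -> : s d ^+ 2 + c * s d + h d =
    s d ^+ 2 * (1 + (c + h d / s d) * (s d)^-1) by field; rewrite gt_eqF.
rewrite sqrtrM ?sqr_ge0// sqrtr_sqr gtr0_norm// invfM mulrA; congr (_ * _).
by field; rewrite gt_eqF.
Unshelve. all: by end_near. Qed.

(** * The phase transition at [1 / (k + 1/2)] *)

Theorem theorem5p1 (R : realType) (known_formula : unique_formula R)
  (k : nat) (n : nat -> nat) (hn : forall d : nat, (d <= n d)%N)
  (gamma : \bar R)
  (hgamma : (ln (n d)%:R / d%:R : R)%:E @[d --> \oo] --> gamma)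
  (disp : nat -> measure_display)
  (T : forall d : nat, measurableType (disp d))
  (P : forall d : nat, probability (T d) R)
  (a : nat -> 'I_k -> R)
  (x : forall d : nat, T d -> 'cV[R]_(n d))
  (G : forall d : nat, T d -> 'M[R]_(d, n d))
  (hmodel : forall d : nat, (k <= n d)%N ->
     signal_model (P d) (a d) (x d) (G d)) :
  [/\ (gamma < ((k%:R + 2^-1)^-1)%:E)%E ->
        prob_unique (P d) (x d) (G d) @[d --> \oo] --> 1%:E,
      (((k%:R + 2^-1)^-1)%:E < gamma)%E ->
        prob_unique (P d) (x d) (G d) @[d --> \oo] --> 0%:E
    & gamma = ((k%:R + 2^-1)^-1)%:E ->
      forall (c : R) (h : nat -> R),
        h =o_\oo (fun d : nat => Num.sqrt (d%:R : R)) ->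
        (forall d : nat, ln (n d)%:R =
           (k%:R + 2^-1)^-1 * (d%:R + c * Num.sqrt d%:R + h d)) ->
        prob_unique (P d) (x d) (G d) @[d --> \oo] -->
          (((Num.sqrt (2 * pi))^-1)%:E *
           \int[lebesgue_measure]_(y in `]-oo, (- c)%R]%classic)
             (expR (- (y ^+ 2) / 2))%:E)%E].
Proof.
set th := k%:R + 2^-1 : R.
have th0 : 0 < th by rewrite /th ltr_wpDl// invr_gt0.
(* The common leading term of mean and variance; it diverges because [n d >= d]. *)
pose L d : R := th * ln (n d)%:R.
have Loo : L d @[d --> \oo] --> +oo.
  apply/cvgryPge => A; near=> d; rewrite /L mulrC -ler_pdivrMr//.
  rewrite -[leLHS]expRK ler_ln ?posrE ?expR_gt0//; last first.
    by rewrite ltr0n (leq_trans _ (hn d))//; near: d; exact: nbhs_infty_gt.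
  apply: (@le_trans _ _ d%:R); last by rewrite ler_nat.
  by near: d; exact: nbhs_infty_ger.
have kn : \forall d \near \oo, (k < n d)%N.
  by near=> d; apply: leq_trans (hn d); near: d; exact: nbhs_infty_gt.
pose ps d : seq R := unique_params k (n d).
have hps d : is_params (ps d) by exact: unique_params_prob.
have [C HC] := @unique_params_meanvar R k.
have HM : \forall d \near \oo, `|pbin_mean (ps d) - L d| <= C.
  by apply: filterS kn => d /HC[].
have HV : \forall d \near \oo, `|pbin_var (ps d) - L d| <= C.
  by apply: filterS kn => d /HC[].
(* For large [d] both [k <= d] and [k < n d] hold, so the known formula reduces each regime to the
   limit of a Bernoulli count. *)
have red (l : R) : pbin_lt (ps d) d @[d --> \oo] --> l ->
    prob_unique (P d) (x d) (G d) @[d --> \oo] --> l%:E.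
  move=> /(cvg_unique_value _ _ _ hn) Hl.
  have Hl' : (unique_value R k d (n d))%:E @[d --> \oo] --> l%:E.
    by apply: cvg_EFin => //; near=> d.
  apply: cvg_trans Hl'; apply: near_eq_cvg; near=> d.
  have knd : (k < n d)%N by near: d; exact: kn.
  rewrite (known_formula _ _ _ _ _ _ (a d))//; last exact/hmodel/ltnW.
  by near: d; exact: nbhs_infty_ge.
split.
(* A real [g] strictly between [gamma] and the threshold gives [L d <= th * g * d] eventually, with
   [th * g < 1]. The supercritical case is symmetric. *)
- move=> gth; have [g gg gt] : exists2 g, (gamma < g%:E)%E & g < th^-1.
    move: gth; case: gamma {hgamma} => [r| |]//.
      rewrite lte_fin => rt; exists ((r + th^-1) / 2); rewrite ?lte_fin; lra.
    by move=> _; exists (th^-1 - 1); [exact: ltNyr|lra].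
  apply: red; apply: (cvg_pbin_lty _ L C) => //.
  apply: (@cvg_standardize_y _ _ Loo (th * g)).
    by rewrite -ltr_pdivlMl// mulr1.
  have H := hgamma _ (open_ereal_lt' gg); near=> d.
  have d0 : (0 : R) < d%:R by rewrite ltr0n; near: d; exact: nbhs_infty_gt.
  have : ((ln (n d)%:R / d%:R : R)%:E < g%:E)%E by near: d; exact: H.
  by rewrite lte_fin ltr_pdivrMr// /L -mulrA ler_pM2l// => /ltW.
- move=> gth; have [g gg gt] : exists2 g, (g%:E < gamma)%E & th^-1 < g.
    move: gth; case: gamma {hgamma} => [r| |]//.
      rewrite lte_fin => rt; exists ((r + th^-1) / 2); rewrite ?lte_fin; lra.
    by move=> _; exists (th^-1 + 1); [exact: ltry|lra].
  apply: red; apply: (cvg_pbin_ltNy _ L C) => //.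
  apply: (@cvg_standardize_Ny _ _ Loo (th * g)).
    by rewrite -ltr_pdivrMl// mulr1.
  have H := hgamma _ (open_ereal_gt' gg); near=> d.
  have d0 : (0 : R) < d%:R by rewrite ltr0n; near: d; exact: nbhs_infty_gt.
  have : (g%:E < (ln (n d)%:R / d%:R : R)%:E)%E by near: d; exact: H.
  by rewrite lte_fin ltr_pdivlMr// /L -mulrA ler_pM2l// => /ltW.
(* Here the factor [th] cancels, leaving [L d = d + c * sqrt d + h d]. *)
- move=> _ c h ho hL; rewrite -std_cdf_integral.
  apply: red; apply: (cvg_pbin_lt _ L C) => //.
  apply: (cvg_standardize_critical _ _ _ ho) => d.
  by rewrite /L hL mulVKf// gt_eqF.
Unshelve. all: by end_near. Qed.
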